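(* Let $\Delta,w\in\mathbb N$ and let $G$ be a digraph with maximum degree $\Delta$ and graded bandwidth $w$. Then $\vec r(G) \leq 3^{57\Delta w}|V(G)|$.
   Context: A digraph $G$ has graded bandwidth at most $w$ if its vertex set can be partitioned into sets $V_1,\dots,V_H$ such that for every edge $uv\in E(G)$ (directed from $u$ to $v$) with $u\in V_i$, $v\in V_j$ we have $1\leq j-i\leq w$ (in particular $G$ is acyclic); ''graded bandwidth $w$'' means graded bandwidth at most $w$. The maximum degree of a digraph is the maximum degree of its underlying undirected graph. A tournament is an orientation of a complete graph; for an acyclic digraph $G$, $\vec r(G)$ is the smallest $N$ such that every tournament on $N$ vertices contains a copy of $G$. *)

(* Defs.v *)
From mathcomp Require Import all_boot.
From mathcomp Require Import zify.

Set Implicit Arguments.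
Unset Strict Implicit.
Unset Printing Implicit Defensive.

(* A finite digraph is its edge relation [e : rel V] on a finite vertex type:
   [e u v] is the edge directed from u to v. *)

Section Digraphs.
Variables (V : finType) (e : rel V).

Definition acyclic : Prop := forall c : seq V, cycle e c -> c = [::].

Definition degree (v : V) : nat := #|[set u | e u v || e v u]|.

Definition max_degree : nat := \max_(v : V) degree v.

(* The map [h] encodes the partition whose i-th part is the fibre of i.
   Subtraction is truncated, so [1 <= h v - h u] forces [h u < h v]. *)
Definition graded_bandwidth_le (w : nat) : Prop :=
  exists (H : nat) (h : V -> 'I_H),
    forall u v : V, e u v -> 1 <= h v - h u <= w.

Definition tournament : bool :=
  [forall x, ~~ e x x] && [forall x, forall y, (x != y) ==> (e x y (+) e y x)].

Lemma tournamentP :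
  reflect (irreflexive e /\ forall x y, x != y -> e x y (+) e y x) tournament.
Proof.
apply: (iffP andP) => -[H1 H2]; split.
- by move=> x; apply/negbTE/(forallP H1).
- by move=> x y; apply/implyP/(forallP (forallP H2 x)).
- by apply/forallP => x; rewrite H1.
- by apply/forallP => x; apply/forallP => y; apply/implyP/H2.
Qed.

(* Not necessarily induced. *)
Definition contains_copy (T : finType) (t : rel T) : bool :=
  [exists f : {ffun V -> T},
    injectiveb f && [forall u, forall v, e u v ==> t (f u) (f v)]].

Lemma contains_copyP (T : finType) (t : rel T) :
  reflect (exists2 f : V -> T, injective f & {homo f : u v / e u v >-> t u v})
          (contains_copy t).
Proof.
apply: (iffP existsP) => [[f /andP[/injectiveP fI /forallP fe]] | [f fI fe]].
  by exists f => // u v; apply/implyP/(forallP (fe u)).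
exists (finfun f); apply/andP; split.
  by apply/injectiveP => u v; rewrite !ffunE; apply: fI.
by apply/forallP => u; apply/forallP => v; apply/implyP; rewrite !ffunE; apply: fe.
Qed.

End Digraphs.

(* Tournaments on N vertices are quantified via their edge sets in 'I_N * 'I_N,
   making the property decidable; [forcesP] is the reading over all vertex types. *)
Definition forces (V : finType) (e : rel V) (N : nat) : bool :=
  [forall E : {set 'I_N * 'I_N},
    tournament (fun x y => (x, y) \in E) ==>
    contains_copy e (fun x y => (x, y) \in E)].

Lemma forcesP (V : finType) (e : rel V) (N : nat) :
  reflect (forall (T : finType) (t : rel T),
             #|T| = N -> tournament t -> contains_copy e t)
          (forces e N).
Proof.
apply: (iffP forallP) => [HE T t cT /tournamentP[t0 tt] | HT E].
  pose g (i : 'I_N) : T := enum_val (cast_ord (esym cT) i).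
  have gI : injective g by move=> i j /enum_val_inj/cast_ord_inj.
  pose E := [set p : 'I_N * 'I_N | t (g p.1) (g p.2)].
  have /implyP/(_ _)/contains_copyP[|f fI fe] := HE E.
    apply/tournamentP; split=> [x | x y nxy]; rewrite !inE ?t0 //=.
    by apply: tt; rewrite (inj_eq gI).
  apply/contains_copyP; exists (g \o f); first exact: inj_comp.
  by move=> u v /fe; rewrite inE.
by apply/implyP/HT; rewrite card_ord.
Qed.

Lemma acyclic_source (V : finType) (e : rel V) (A : {set V}) :
  acyclic e -> A != set0 ->
  exists2 x, x \in A & forall y, y \in A -> ~~ e y x.
Proof.
move=> ac /set0Pn[x0 x0A].
case: (boolP [exists x in A, [forall y in A, ~~ e y x]]).
  by case/exists_inP=> x xA /forall_inP; exists x.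
move=> /exists_inPn noS; exfalso.
have pr x : x \in A -> exists y, (y \in A) && e y x.
  move=> xA; have /forall_inPn[y yA /negPn yx] := noS x xA.
  by exists y; rewrite yA.
have [p pP] : exists p : V -> V, forall x, x \in A -> (p x \in A) && e (p x) x.
  exists (fun x => odflt x [pick y | (y \in A) && e y x]) => x xA.
  case: pickP => //= none; have [y] := pr x xA; by rewrite none.
have itA n : iter n p x0 \in A.
  by elim: n => //= n /pP /andP[].
have walk n m : path (fun x y => e y x) (iter n p x0) (traject p (iter n.+1 p x0) m).
  elim: m n => //= m IH n; rewrite (IH n.+1) andbT.
  by have /andP[] := pP _ (itA n).
have /uniqPn : ~~ uniq (traject p x0 #|V|.+1).
  apply/negP => /card_uniqP; rewrite size_traject => E.
  by have := max_card (mem (traject p x0 #|V|.+1)); rewrite E ltnn.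
case/(_ x0) => i [j] [ij]; rewrite size_traject => jV.
rewrite !nth_traject ?(ltn_trans ij) // => Eij.
have cyc : cycle (fun x y => e y x) (traject p (iter i p x0) (j - i)).
  have -> : j - i = (j - i).-1.+1 by rewrite prednK // subn_gt0.
  rewrite /= -iterS.
  have -> : rcons (traject p (iter i.+1 p x0) (j - i).-1) (iter i p x0) =
            traject p (iter i.+1 p x0) (j - i).
    rewrite -[in RHS](@prednK (j - i)) ?subn_gt0 // trajectSr -iterD.
    by congr rcons; rewrite Eij; congr iter; lia.
  exact: walk.
move: cyc; rewrite -rev_cycle => /ac /(congr1 size).
by rewrite size_rev size_traject /=; lia.
Qed.

Lemma tournament_half (T : finType) (t : rel T) (B : {set T}) :
  tournament t -> B != set0 ->
  exists2 y, y \in B & #|B| <= (#|[set z in B | t y z]|.*2).+1.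
Proof.
move=> /tournamentP[t0 tt] B0.
pose o y := #|[set z in B | t y z]|; pose i y := #|[set z in B | t z y]|.
have io y : y \in B -> #|B| = (o y + i y).+1.
  move=> yB; rewrite (cardsD1 y) yB add1n; congr _.+1.
  rewrite /o /i -cardsUI.
  have -> : [set z in B | t y z] :&: [set z in B | t z y] = set0.
    apply/setP=> z; rewrite !inE; have [->|nyz] := eqVneq y z.
      by rewrite t0 andbF.
    by have := tt _ _ nyz; case: (t y z); case: (t z y); rewrite ?andbF.
  rewrite cards0 addn0; apply: eq_card => z; rewrite !inE eq_sym.
  have [<-|nyz] := eqVneq y z; first by rewrite t0 !andbF.
  by have := tt _ _ nyz; case: (t y z); case: (t z y); rewrite ?andbF ?andbT ?orbF.
have Soi : \sum_(y in B) o y = \sum_(y in B) i y.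
  have E (r : rel T) y : #|[set z in B | r y z]| = \sum_(z in B) r y z.
    rewrite -sum1_card [RHS]big_mkcond [LHS]big_mkcond; apply: eq_bigr => z _.
    by rewrite inE; case: (z \in B); case: (r y z).
  rewrite /o /i (eq_bigr _ (fun y _ => E t y)).
  by rewrite (eq_bigr _ (fun y _ => E (fun a b => t b a) y)) exchange_big.
case: (boolP [exists y in B, i y <= o y]).
  case/exists_inP=> y yB le; exists y => //; rewrite (io y yB) ltnS -addnn.
  by rewrite leq_add2l.
move=> /exists_inPn lt; exfalso.
have : \sum_(y in B) (o y).+1 <= \sum_(y in B) i y.
  by apply: leq_sum => y /lt; rewrite -ltnNge.
under eq_bigr => y _ do rewrite -addn1.
rewrite big_split /= sum1_card Soi -[leqRHS]addn0 leq_add2l leqn0 cards_eq0.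
by apply/negP.
Qed.

Lemma acyclic_forces (V : finType) (e : rel V) :
  acyclic e -> exists N, forces e N.
Proof.
move=> ac; exists (2 ^ #|V|); apply/forcesP => T t cT tT.
have [t0 _] := tournamentP _ tT.
suff emb n : forall (A : {set V}) (B : {set T}), #|A| = n -> 2 ^ n <= #|B| ->
    exists f : V -> T, [/\ {in A, forall x, f x \in B}, {in A &, injective f}
      & {in A &, {homo f : u v / e u v >-> t u v}}].
  have [||f [_ fI fe]] := emb #|V| [set: V] [set: T]; rewrite ?cardsT ?cT //.
  apply/contains_copyP; exists f => [u v|u v]; first by apply: fI; rewrite inE.
  by apply: fe; rewrite inE.
elim: n => [|n IH] A B cA cB.
  have /set0Pn[b bB] : B != set0 by rewrite -card_gt0; apply: leq_trans cB.
  have A0 x : x \in A = false by rewrite (cards0_eq cA) inE.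
  by exists (fun=> b); split=> x; rewrite ?A0 // => y; rewrite A0.
have [x xA xs] : exists2 x, x \in A & forall y, y \in A -> ~~ e y x.
  by apply: acyclic_source; rewrite // -card_gt0 cA.
have B0 : B != set0 by rewrite -card_gt0; apply: leq_trans cB; rewrite expn_gt0.
have [y yB yh] := tournament_half tT B0.
have [||f [fB fI fe]] := IH (A :\ x) [set z in B | t y z].
- by have := cardsD1 x A; rewrite xA cA => -[].
- by move: cB yh; rewrite expnS; move: (2 ^ n) #|_| #|_| => *; lia.
exists (fun v => if v == x then y else f v).
have fP u : u \in A -> u != x -> (f u \in B) && t y (f u).
  by move=> uA ux; have := fB u; rewrite !inE ux uA; apply.
have fy u : u \in A -> u != x -> f u != y.
  move=> uA ux; apply: contraTneq (fP u uA ux) => ->.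
  by rewrite t0 andbF.
split=> [u uA | u v uA vA | u v uA vA].
- by case: eqVneq => // ux; case/andP: (fP u uA ux).
- case: (eqVneq u x) => [->|ux]; case: (eqVneq v x) => [->|vx] //.
  + by move=> E; have := fy v vA vx; rewrite -E eqxx.
  + by move=> E; have := fy u uA ux; rewrite E eqxx.
  + by apply: fI; rewrite !inE ?ux ?vx.
- case: (eqVneq v x) => [->|vx]; first by rewrite (negbTE (xs u uA)).
  case: (eqVneq u x) => [_ _|ux]; first by case/andP: (fP v vA vx).
  by apply: fe; rewrite !inE ?ux ?vx.
Qed.

(* The oriented Ramsey number of an acyclic digraph. *)
Definition oriented_ramsey (V : finType) (e : rel V) (ac : acyclic e) : nat :=
  ex_minn (acyclic_forces ac).

Lemma graded_bandwidth_acyclic (V : finType) (e : rel V) (w : nat) :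
  graded_bandwidth_le e w -> acyclic e.
Proof.
move=> [H [h hP]] [|x c] //= cyc; exfalso.
have hlt u v : e u v -> h u < h v by move/hP; lia.
suff main : forall c x y, path e x (rcons c y) -> h x < h y.
  by have := main _ _ _ cyc; rewrite ltnn.
elim=> [|z s IH] a b /=; first by rewrite andbT; apply: hlt.
by move=> /andP[/hlt lt1 /IH]; apply: ltn_trans.
Qed.

(* Main.v *)
Require Import Defs.
From mathcomp Require Import all_boot all_order all_algebra.
From mathcomp Require Import zify ring lra.

(* Group the levels of [G] into blocks of [w] consecutive levels, so that edges
   stay inside a block or join consecutive blocks, and place the blocks, starting
   from the last one, in consecutive windows of a median order of the tournament,
   the window of a block being proportional to its number of vertices. In such an
   order every vertex of a window is dominated by about half of any long enough
   adjacent interval.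

   Inside the current window take [8 Delta w] nested layers [(y, A)], each [y]
   being a vertex of [A] dominated by a third of the remaining set, which is then
   replaced by the in-neighbourhood of [y]. As in dependent random choice, [y] is
   picked in [A] so that few [Delta]-tuples of its in-neighbours have few common
   out-neighbours in [A]. In the next window, a typical vertex dominates a third of
   the points [y]; by pigeonhole many vertices dominate the same [2 Delta w] of
   them. Cutting these into [w] groups of [2 Delta] gives one group per level: a
   tuple that is bad for all the layers of a group is then so unlikely that a
   random greedy embedding, derandomized by conditional expectations, succeeds. *)

Set Implicit Arguments.
Unset Strict Implicit.
Unset Printing Implicit Defensive.

Import Order.TTheory GRing.Theory Num.Theory.

Local Open Scope ring_scope.

(** * Random greedy embedding *)

Section Expectation.
Variable T : finType.
Implicit Types (W : T -> rat) (Ws : seq (T -> rat)) (F G : seq T -> rat).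

Fixpoint expect Ws F : rat :=
  if Ws is W :: Ws' then \sum_x W x * expect Ws' (fun s => F (x :: s))
  else F [::].

Definition dirac (a x : T) : rat := (x == a)%:R.

Lemma sum_dirac a (F : T -> rat) : \sum_x dirac a x * F x = F a.
Proof.
rewrite (bigD1 a) //= /dirac eqxx mul1r big1 ?addr0 // => x /negbTE ->.
by rewrite mul0r.
Qed.

Lemma expect_le Ws F G :
  (forall W, List.In W Ws -> forall x, 0 <= W x) -> (forall s, F s <= G s) ->
  expect Ws F <= expect Ws G.
Proof.
elim: Ws F G => [|W Ws IH] F G W0 FG /=; first exact: FG.
apply: ler_sum => x _; apply: ler_wpM2l; first by apply: W0; left.
by apply: IH => // W' W'W; apply: W0; right.
Qed.

Lemma expect_eq Ws F G : F =1 G -> expect Ws F = expect Ws G.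
Proof.
elim: Ws F G => [|W Ws IH] F G FG /=; first exact: FG.
by apply: eq_bigr => x _; congr (_ * _); apply: IH.
Qed.

Lemma expectZ Ws c F : expect Ws (fun s => c * F s) = c * expect Ws F.
Proof.
elim: Ws F => //= W Ws IH F; rewrite big_distrr /=.
by apply: eq_bigr => x _; rewrite IH mulrCA.
Qed.

Lemma expect_sum Ws (A : {set T}) (F : T -> seq T -> rat) :
  expect Ws (fun s => \sum_(y in A) F y s) = \sum_(y in A) expect Ws (F y).
Proof.
elim: Ws F => //= W Ws IH F; rewrite exchange_big /=.
by apply: eq_bigr => x _; rewrite IH big_distrr.
Qed.

Lemma expect_ge0 Ws F :
  (forall W, List.In W Ws -> forall x, 0 <= W x) -> (forall s, 0 <= F s) ->
  0 <= expect Ws F.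
Proof.
elim: Ws F => [|W Ws IH] F W0 F0 /=; first exact: F0.
apply: sumr_ge0 => x _; apply: mulr_ge0; first by apply: W0; left.
by apply: IH => // W' W'W; apply: W0; right.
Qed.

Lemma nseq_ge0 W k : (forall x, 0 <= W x) ->
  forall W', List.In W' (nseq k W) -> forall x, 0 <= W' x.
Proof. by move=> W0 W'; elim: k => //= k IH [<-|]. Qed.

Lemma expect_const W k c : \sum_x W x = 1 -> expect (nseq k W) (fun=> c) = c.
Proof.
by move=> W1; elim: k => //= k ->; rewrite -big_distrl /= W1 mul1r.
Qed.

Section Family.
Variables (V : eqType).
Implicit Types (P : V -> T -> rat) (l : seq V).

Lemma map_ge0 P l : (forall u x, 0 <= P u x) ->
  forall W, List.In W (map P l) -> forall x, 0 <= W x.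
Proof. by move=> P0 W; elim: l => //= u l IH [<-|]. Qed.

(** Each independent draw costs one factor [R]. This carries the rarity of bad tuples from one
    reference measure [W] to the actual distributions of the in-neighbours. *)
Lemma expect_dominated P l W R F :
  0 <= R -> (forall u x, 0 <= P u x) -> (forall x, 0 <= W x) ->
  {in l, forall u x, P u x <= R * W x} -> (forall s, 0 <= F s) ->
  expect (map P l) F <= R ^+ size l * expect (nseq (size l) W) F.
Proof.
move=> R0 P0 W0; elim: l F => [|u l IH] F PW F0 /=; first by rewrite mul1r.
rewrite big_distrr /=; apply: ler_sum => x _.
have := IH (fun s => F (x :: s)) _ _.
move=> /(_ (fun v vl => PW v (mem_behead (s := u :: l) vl)) (fun s => F0 _)) le.
rewrite exprS (_ : R * _ * _ = (R * W x) *
  (R ^+ size l * expect (nseq (size l) W) (fun s => F (x :: s)))); last by ring.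
apply: ler_pM => //; last by apply: PW; rewrite mem_head.
by apply: expect_ge0 => //; apply: map_ge0.
Qed.

Lemma expect_dirac (f : V -> T) P l F : {in l, forall u, P u = dirac (f u)} ->
  expect (map P l) F = F (map f l).
Proof.
elim: l F => //= u l IH F Pf; rewrite Pf ?mem_head // sum_dirac IH // => v vl.
by apply: Pf; rewrite in_cons vl orbT.
Qed.

(** Law of total expectation over the image of [u]; uniqueness of [l] makes [u] occupy a single
    coordinate. *)
Lemma expect_cond P (Q : T -> V -> T -> rat) l u F : uniq l -> u \in l ->
    (forall a, Q a u = dirac a) -> (forall a v, v != u -> Q a v = P v) ->
  expect (map P l) F = \sum_a P u a * expect (map (Q a) l) F.
Proof.
move=> ul uin Qu Qv; elim: l F ul uin => //= v l IH F /andP[vl ul].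
have [uv|nvu] := eqVneq u v; rewrite in_cons => uin.
  subst v.
  apply: eq_bigr => a _; rewrite Qu sum_dirac; congr (_ * expect _ _).
  by apply/eq_in_map => z zl; rewrite Qv //; apply: contraNneq vl => <-.
rewrite (negbTE nvu) /= in uin.
under eq_bigr => x _ do rewrite (IH _ ul uin) big_distrr /=.
rewrite exchange_big /=; apply: eq_bigr => a _; rewrite big_distrr /=.
apply: eq_bigr => x _; rewrite Qv 1?eq_sym //; ring.
Qed.

End Family.
End Expectation.

(** * Greedy embedding by conditional expectations *)

Section Embedding.
Variables (V T : finType) (e : rel V) (t : rel T) (depth : V -> nat).
Variables (part : V -> nat) (P : V -> T -> rat) (B : V -> pred (seq T)).
Variables (Delta : nat) (eps K eta eta' : rat).
Let inn v := enum [pred u | e u v].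

Hypothesis depth_lt : forall u v, e u v -> (depth v < depth u)%N.
Hypothesis indeg : forall v, (#|[pred u | e u v]| <= Delta)%N.
Hypothesis outdeg : forall u, (#|[pred v | e u v]| <= Delta)%N.
Hypothesis P_ge0 : forall v x, 0 <= P v x.
Hypothesis P_part : forall u v x, 0 < P u x -> 0 < P v x -> part u = part v.
Hypothesis P_spread : forall v x,
  P v x * #|[pred u | part u == part v]|%:R <= eta.
Hypothesis bad_rare : forall v,
  expect (map P (inn v)) (fun s => (B v s)%:R) <= eps.
Hypothesis not_bad : forall v s,
  (forall z, z \in s -> exists2 u, e u v & 0 < P u z) -> ~~ B v s ->
  eta' <= \sum_(x | all (t^~ x) s) P v x.
Hypothesis eps_gt0 : 0 < eps.
Hypothesis K_ge1 : 1 <= K.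
Hypothesis eps_small : eps * K ^+ Delta < 1.
Hypothesis eta_small : eta + Delta%:R / K < eta'.

(* Vertices outside [S] are still random; the expectation of [B v] under [wt S f]
   is the conditional probability that [v] ends up with an unusable tuple. *)
Let wt (S : {set V}) (f : V -> T) (u : V) : T -> rat :=
  if u \in S then dirac (f u) else P u.

(** In the last clause, each embedded in-neighbour of [v] may raise the conditional probability of a
    bad tuple by a factor [K]. *)
Let good_partial (S : {set V}) (f : V -> T) : Prop :=
  [/\ {in S &, injective f}, forall u, u \in S -> 0 < P u (f u),
      {in S &, {homo f : u v / e u v >-> t u v}} &
      forall v, expect (map (wt S f) (inn v)) (fun s => (B v s)%:R)
                <= eps * K ^+ #|[pred u in S | e u v]|].

(** Union bound under [P u]: the vertices dominated by all images of in-neighbours have mass at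
    least [eta'], the used ones at most [eta], and each out-neighbour excludes at most [1 / K]. *)
Lemma extend_partial (S : {set V}) (f : V -> T) (u : V) :
    u \notin S -> (forall z, e z u -> z \in S) ->
    (forall v, e u v -> v \notin S) ->
    good_partial S f -> exists g, good_partial (u |: S) g.
Proof.
move=> uS inS outS [fI fP fe fB].
have Kgt0 : 0 < K by apply: lt_le_trans K_ge1.
pose upd x z := if z == u then x else f z.
pose bound v := eps * K ^+ #|[pred z in S | e z v]|.
have bound_gt0 v : 0 < bound v by rewrite mulr_gt0 ?exprn_gt0.
pose cond x v := expect (map (wt (u |: S) (upd x)) (inn v)) (fun s => (B v s)%:R).
pose viol v := [pred x | K * bound v < cond x v].
have wt_ge0 S' f' z x : 0 <= wt S' f' z x.
  by rewrite /wt; case: ifP => // _; rewrite ler0n.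
have condE v : e u v ->
    expect (map (wt S f) (inn v)) (fun s => (B v s)%:R) = \sum_x P u x * cond x v.
  move=> uv; rewrite (expect_cond (Q := fun x => wt (u |: S) (upd x)) (u := u)).
  - by apply: eq_bigr => x _; rewrite /wt (negbTE uS).
  - exact: enum_uniq.
  - by rewrite mem_enum.
  - by move=> a; rewrite /wt setU11 /upd eqxx.
  - by move=> a z zu; rewrite /wt in_setU1 /upd (negbTE zu).
(* Markov's inequality for the conditional probability, whose mean is at most [bound v]. *)
have viol_le v : e u v -> \sum_(x | viol v x) P u x <= K^-1.
  move=> uv; have := fB v; rewrite condE // -/(bound v) => le.
  have : K * bound v * \sum_(x | viol v x) P u x <= bound v.
    apply: le_trans le; rewrite big_distrr /= [leRHS](bigID (viol v)) /=.
    rewrite -[leLHS]addr0; apply: lerD.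
      by apply: ler_sum => x /ltW le; rewrite mulrC; apply: ler_wpM2l.
    apply: sumr_ge0 => x _; apply: mulr_ge0 => //.
    by apply: expect_ge0 => [|s]; [apply: map_ge0 | rewrite ler0n].
  rewrite mulrAC -ler_pdivlMr // mulfV ?gt_eqF // => le1.
  by rewrite -[K^-1]mul1r ler_pdivlMr // mulrC.
(* Different parts have disjoint supports, so only images of vertices in the part of [u] carry mass
   under [P u]. *)
have used_le : \sum_(x | x \in f @: S) P u x <= eta.
  pose Z := [set z in S | part z == part u].
  have le1 : \sum_(x in f @: S) P u x <= \sum_(z in Z) P u (f z).
    rewrite (big_imset _ fI) /= (bigID (mem Z)) /=.
    rewrite [X in _ + X]big1 ?addr0 => [|z /andP[zS]]; last first.
      rewrite inE zS /= => nz; apply/eqP; rewrite eq_le P_ge0 andbT leNgt.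
      by apply: contra nz => /(P_part (fP z zS)) ->.
    rewrite le_eqVlt; apply/orP; left; apply/eqP; apply: eq_bigl => z.
    by rewrite !inE; case: (z \in S).
  apply: le_trans le1 _.
  have [Z0|[z zZ]] := set_0Vmem Z.
    by rewrite Z0 big_set0; apply: le_trans (P_spread u (f u)); rewrite mulr_ge0 ?ler0n.
  have [x _ xmax] := @arg_maxP _ _ T (f z) xpredT (P u) isT.
  apply: le_trans (P_spread u x).
  apply: le_trans (_ : \sum_(z in Z) P u x <= _).
    by apply: ler_sum => z' _; apply: xmax.
  rewrite sumr_const -[leLHS]mulr_natr; apply: ler_wpM2l => //.
  by rewrite ler_nat subset_leq_card //; apply/subsetP => z'; rewrite !inE => /andP[].
have cand_ge : eta' <= \sum_(x | all (t^~ x) (map f (inn u))) P u x.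
  apply: not_bad => [z /mapP[v]|].
    by rewrite mem_enum => vu ->; exists v => //; apply/fP/inS.
  (* All in-neighbours of [u] are embedded, so the conditional probability is 0 or 1, and 1
     contradicts [eps_small]. *)
  apply: contraTN eps_small => Bu; rewrite -leNgt.
  have := fB u; rewrite (expect_dirac (f := f)); last first.
    by move=> z; rewrite mem_enum => zu; rewrite /wt inS.
  rewrite Bu => le1; apply: le_trans le1 _; rewrite ler_pM2l //.
  apply: ler_weXn2l => //; apply: leq_trans (indeg u).
  by apply/subset_leq_card/subsetP => z; rewrite !inE => /andP[].
have [x /and3P[xP xall xused] xviol] : exists2 x,
    [&& 0 < P u x, all (t^~ x) (map f (inn u)) & x \notin f @: S] &
    forall v, e u v -> ~~ viol v x.
  pose ok x := [&& 0 < P u x, all (t^~ x) (map f (inn u)), x \notin f @: S &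
    [forall v, e u v ==> ~~ viol v x]].
  have [x /and4P[xP xall xused /forallP xv]|nok] := pickP ok.
    exists x; first by rewrite xP xall xused.
    by move=> v uv; have := xv v; rewrite uv.
  suff : eta' <= eta + Delta%:R / K by rewrite leNgt eta_small.
  apply: le_trans cand_ge _.
  apply: le_trans (_ : \sum_(x | x \in f @: S) P u x +
     \sum_(v | e u v) \sum_(x | viol v x) P u x <= _).
    have -> : \sum_(v | e u v) \sum_(x | viol v x) P u x =
              \sum_x P u x * \sum_(v | e u v) (viol v x)%:R.
      under [RHS]eq_bigr => x _ do rewrite big_distrr /=.
      rewrite exchange_big /=; apply: eq_bigr => v _.
      rewrite big_mkcond /=; apply: eq_bigr => x _.
      by case: ifP; rewrite ?mulr1 ?mulr0.
    rewrite [X in X + _]big_mkcond [leLHS]big_mkcond /= -big_split /=.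
    apply: ler_sum => x _.
    have nn : 0 <= \sum_(v | e u v) (viol v x)%:R :> rat.
      by apply: sumr_ge0 => v _; rewrite ler0n.
    have nn' := mulr_ge0 (P_ge0 u x) nn.
    have := nok x; rewrite /ok; case: (ltP 0 (P u x)) => [xP|xP _]; last first.
      have -> : P u x = 0 by apply/eqP; rewrite eq_le xP P_ge0.
      by rewrite !if_same mul0r addr0.
    case: ifP => _ /=; last by case: ifP => _; rewrite ?add0r ?addr_ge0.
    case: ifP => xf /=; first by rewrite lerDl.
    move/negbT/forallPn => [v]; rewrite negb_imply negbK => /andP[uv xv].
    rewrite add0r -[leLHS]mulr1 ler_pM2l // (bigD1 v) //= xv lerDl.
    by apply: sumr_ge0 => v' _; rewrite ler0n.
  apply: lerD => //.
  apply: le_trans (_ : \sum_(v | e u v) K^-1 <= _); first exact: ler_sum.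
  rewrite sumr_const -[leLHS]mulr_natl; apply: ler_wpM2r.
    by rewrite invr_ge0 ltW.
  by rewrite ler_nat outdeg.
exists (upd x).
have updS z : z \in S -> upd x z = f z.
  by move=> zS; rewrite /upd; case: eqVneq => // zu; rewrite -zu zS in uS.
have updu : upd x u = x by rewrite /upd eqxx.
have xf z : z \in S -> f z != x.
  by move=> zS; apply: contraNneq xused => <-; apply: imset_f.
split.
- move=> y z /setU1P[->|yS] /setU1P[->|zS]; rewrite ?updu ?updS //.
  + by move=> xE; have := xf z zS; rewrite -xE eqxx.
  + by move=> xE; have := xf y yS; rewrite xE eqxx.
  + exact: fI.
- by move=> z /setU1P[->|zS]; rewrite ?updu ?updS //; apply: fP.
- move=> y z /setU1P[->|yS] /setU1P[->|zS] yz; rewrite ?updu ?updS //.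
  + by have := depth_lt yz; rewrite ltnn.
  + by have := outS z yz; rewrite zS.
  + by apply: (allP xall); apply: map_f; rewrite mem_enum.
  + exact: fe.
- move=> v; have [uv|uv] := boolP (e u v).
    have := xviol v uv; rewrite /= -leNgt => /le_trans; apply.
    rewrite mulrCA -exprS ler_pM2l // ler_weXn2l //.
    rewrite [leqRHS](cardD1 u) !inE eqxx uv /= add1n ltnS.
    apply/subset_leq_card/subsetP => z; rewrite !inE => /andP[zS ->].
    by rewrite zS orbT !andbT; apply: contraNneq uS => <-.
  have -> : map (wt (u |: S) (upd x)) (inn v) = map (wt S f) (inn v).
    apply/eq_in_map => z; rewrite mem_enum inE => zv.
    have zu : z != u by apply: contraNneq uv => <-.
    by rewrite /wt in_setU1 (negbTE zu) /=; case: ifP => // zS; rewrite updS.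
  apply: le_trans (fB v) _; rewrite ler_pM2l // ler_weXn2l //.
  apply/subset_leq_card/subsetP => z; rewrite !inE => /andP[-> ->].
  by rewrite orbT.
Qed.

(** Vertices are embedded by decreasing depth, so in-neighbours always come before and
    out-neighbours after. *)
Lemma random_greedy_embedding (x0 : T) :
  exists2 f : V -> T, injective f & {homo f : u v / e u v >-> t u v}.
Proof.
suff main n : (n <= #|V|)%N -> exists (S : {set V}) f,
    [/\ #|S| = n, (forall u v, v \in S -> (depth v < depth u)%N -> u \in S) &
        good_partial S f].
  have [S [f [cS _ [fI _ fe _]]]] := main _ (leqnn _).
  have ST z : z \in S.
    have -> : S = setT by apply/eqP; rewrite eqEcard subsetT cardsT cS leqnn.
    by rewrite inE.
  by exists f => [u v|u v]; [apply: fI | apply: fe].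
elim: n => [_|n IH nV].
  exists set0, (fun=> x0); split; first by rewrite cards0.
    by move=> u v; rewrite inE.
  split=> [u v|u|u v|v]; rewrite ?inE //.
  rewrite [#|_|]eq_card0 ?expr0 ?mulr1 => [|z]; last by rewrite !inE.
  apply: le_trans (bad_rare v); rewrite le_eqVlt; apply/orP; left; apply/eqP.
  by congr expect; apply: eq_map => z; rewrite /wt inE.
have [S [f [cS Sup gS]]] := IH (ltnW nV).
have [u0 u0S] : exists u, u \in ~: S.
  by apply/set0Pn; rewrite -card_gt0 cardsCs setCK cS subn_gt0.
have [u uS umax] := @arg_maxnP _ u0 (mem (~: S)) depth u0S.
rewrite !inE in uS.
have inS z : (depth u < depth z)%N -> z \in S.
  by apply: contraTT => zS; rewrite -leqNgt; apply: umax; rewrite !inE.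
have [|v uv|g gP] := extend_partial uS _ _ gS.
- by move=> z /depth_lt/inS.
- by apply: contra uS => vS; apply: Sup vS (depth_lt uv).
exists (u |: S), g; split=> //; first by rewrite cardsU1 uS cS.
move=> y v /setU1P[->|vS] lt; first by rewrite in_setU1 inS ?orbT.
by rewrite in_setU1 (Sup y v) ?orbT.
Qed.

End Embedding.

(** * Dependent random choice in nested layers *)

Section Layers.
Variables (T : finType) (t : rel T).
Hypothesis tT : tournament t.

(** The slack 2 is absorbed by integrality: [3 ^ M.+1 <= #|D|] still leaves [3 ^ M]
    in-neighbours. *)
Definition rich (D : {set T}) : {set T} :=
  [set y in D | (#|D| <= 3 * #|[set z in D | t z y]| + 2)%N].

(** Otherwise at least two thirds of [D] are not rich, and one of these vertices has about half of
    them as in-neighbours, hence about a third of [D]. *)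
Lemma rich_card (D : {set T}) : D != set0 -> (#|D| < 3 * #|rich D|)%N.
Proof.
move=> D0; have rD : rich D \subset D by apply/subsetP => y; rewrite inE => /andP[].
have := cardsID (rich D) D; rewrite (setIidPr rD).
have [-> | B0] := eqVneq (D :\: rich D) set0.
  by rewrite cards0 -card_gt0 in D0 *; lia.
have rT : tournament (fun x y => t y x).
  apply/tournamentP; have [t0 tt] := tournamentP _ tT; split=> // x y xy.
  by apply: tt; rewrite eq_sym.
have [y] := tournament_half rT B0; rewrite !inE => /andP[+ yD]; rewrite yD /=.
have : (#|[set z in D :\: rich D | t z y]| <= #|[set z in D | t z y]|)%N.
  by apply/subset_leq_card/subsetP => z; rewrite !inE => /andP[/andP[_ ->]].
move: (#|[set z in _ :\: _ | _]|) (#|[set z in D | _]|) (#|rich D|) => a b c.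
move: #|D :\: _| #|D| => d f; lia.
Qed.

Variable mu : rat.
Hypothesis mu_gt0 : 0 < mu.

Definition common (A : {set T}) (s : seq T) : {set T} :=
  [set x in A | all (t^~ x) s].

(* In a layer [l = (y, A)] the point [y] lies in [A], and the earlier vertices
   of [G] are embedded into in-neighbours of [y]. *)
Definition badhit (s : seq T) (l : T * {set T}) : bool :=
  all (t^~ l.1) s && (#|common l.2 s|%:R < mu * #|l.2|%:R).

(** An exponential moment of the number of bad hits: it is at least [mu ^- q] on a tuple bad for [q]
    layers, while a well chosen layer at most doubles its mean. *)
Definition penalty (L : seq (T * {set T})) (s : seq T) : rat :=
  \prod_(l <- L) (1 + (badhit s l)%:R / mu).

Lemma penalty_ge0 L s : 0 <= penalty L s.
Proof.
apply: prodr_ge0 => l _; apply: addr_ge0 => //.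
by rewrite divr_ge0 ?ler0n // ltW.
Qed.

Lemma penalty_ge L s : mu <= 1 -> (mu ^-1) ^+ count (badhit s) L <= penalty L s.
Proof.
move=> mu1; have mu1' : 1 <= mu^-1 by rewrite invf_ge1.
elim: L => [|l L IH] /=; first by rewrite /penalty big_nil.
rewrite /penalty big_cons -/(penalty L s) exprD; apply: ler_pM => //.
- by rewrite exprn_ge0 // invr_ge0 ltW.
- by rewrite exprn_ge0 // invr_ge0 ltW.
by case: badhit; rewrite ?expr0 ?expr1 ?mul1r ?mul0r ?addr0 // lerDr.
Qed.

(* A random [y] in [A] hits a tuple with few common out-neighbours in [A] with
   probability less than [mu], so on average the penalty at most doubles. *)
Lemma penalty_step (Delta : nat)
    (nu : T -> rat) (A : {set T}) (G : seq T -> rat) :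
  (forall x, 0 <= nu x) -> (forall s, 0 <= G s) -> A != set0 ->
  exists2 y, y \in A &
    \sum_(k < Delta.+1) expect (nseq k nu)
       (fun s => G s * (1 + (badhit s (y, A))%:R / mu))
    <= 2 * \sum_(k < Delta.+1) expect (nseq k nu) G.
Proof.
move=> nu0 G0 A0; set E := \sum_(k < _) expect _ G.
pose H y := \sum_(k < Delta.+1) expect (nseq k nu)
       (fun s => G s * (1 + (badhit s (y, A))%:R / mu)).
have [/exists_inP //|] := boolP [exists y in A, H y <= 2 * E].
move/exists_inPn => no; exfalso.
have cA : 0 < #|A|%:R :> rat by rewrite ltr0n card_gt0.
have : #|A|%:R * (2 * E) < \sum_(y in A) H y.
  rewrite mulr_natl -sumr_const; case/set0Pn: A0 => y yA.
  rewrite (bigD1 y) // [ltRHS](bigD1 y) //=; apply: ltr_leD.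
    by have := no y yA; rewrite -ltNge.
  by apply: ler_sum => z /andP[zA _]; have := no z zA; rewrite -ltNge => /ltW.
rewrite exchange_big /= ltNge => /negP; apply.
rewrite /E mulrA big_distrr /=; apply: ler_sum => k _.
rewrite -expect_sum -expectZ; apply: expect_le; first exact: nseq_ge0.
move=> s; rewrite -big_distrr /= mulrC; apply: ler_wpM2r => //.
rewrite (_ : _ * 2 = #|A|%:R + #|A|%:R); last by ring.
rewrite big_split /= sumr_const lerD2l -big_distrl /=.
rewrite ler_pdivrMr // -natr_sum.
have [small|big] := boolP (#|common A s|%:R < mu * #|A|%:R).
  apply: ltW; rewrite mulrC; apply: le_lt_trans small; rewrite ler_nat.
  rewrite -sum1_card big_mkcond [leqRHS]big_mkcond; apply: leq_sum => y _.
  rewrite inE; case: (y \in A) => //; rewrite /badhit /=.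
  by case: all => //=; case: (_ < _).
rewrite big1 => [|y yA]; first by rewrite mulr_ge0 ?ltW.
by rewrite /badhit /= (negbTE big) andbF.
Qed.

(** Iterates [penalty_step] on [rich D], then passes to the in-neighbours in [D] of the chosen
    point, so later sets dominate earlier points. Summing over all lengths up to [Delta] makes one
    choice serve them all; [G] carries the penalties of the layers already chosen. *)
Lemma layers (Delta : nat) (nu : T -> rat) : (forall x, 0 <= nu x) ->
  forall (M : nat) (D : {set T}) (G : seq T -> rat), (forall s, 0 <= G s) ->
  (3 ^ M <= #|D|)%N ->
  exists L : seq (T * {set T}),
  [/\ size L = M,
      forall l, l \in L -> [/\ l.1 \in l.2, l.2 \subset D &
                               (#|D| < 3 ^ M * #|l.2|)%N],
      pairwise (fun l l' : T * {set T} => [forall x in l'.2, t x l.1]) L &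
      \sum_(k < Delta.+1) expect (nseq k nu) (fun s => G s * penalty L s)
      <= 2 ^+ M * \sum_(k < Delta.+1) expect (nseq k nu) G].
Proof.
move=> nu0; elim=> [|M IH] D G G0 cD.
  exists [::]; split=> //; rewrite expr0 mul1r; apply: ler_sum => k _.
  rewrite le_eqVlt; apply/orP; left; apply/eqP; apply: expect_eq => s.
  by rewrite /penalty big_nil mulr1.
have D0 : D != set0 by rewrite -card_gt0; apply: leq_trans cD; rewrite expn_gt0.
have cR := rich_card D0.
have R0 : rich D != set0 by rewrite -card_gt0; lia.
have [y yR ystep] := penalty_step Delta nu0 G0 R0.
pose D1 := [set z in D | t z y].
move: (yR); rewrite inE => /andP[yD]; rewrite -/D1 => cD1.
pose G1 s := G s * (1 + (badhit s (y, rich D))%:R / mu).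
have G10 s : 0 <= G1 s.
  rewrite mulr_ge0 // addr_ge0 // divr_ge0 ?ler0n //; exact: ltW.
have [|L [sL lL pL eL]] := IH D1 G1 G10.
  by move: cD; rewrite expnS; lia.
exists ((y, rich D) :: L); split => /=; first by rewrite sL.
- move=> l; rewrite in_cons => /predU1P[-> /=|lin].
    split=> //; first by apply/subsetP => z; rewrite inE => /andP[].
    apply: leq_trans cR _; rewrite expnS -mulnA leq_mul2l /=.
    by rewrite leq_pmull // expn_gt0.
  have [l1 l2 l3] := lL l lin; split=> //.
    by apply: subset_trans l2 _; apply/subsetP => z; rewrite inE => /andP[].
  by rewrite expnS -mulnA; move: cD1 l3; clear; move: (_ * #|l.2|)%N => c; lia.
- rewrite pL andbT; apply/allP => l /lL[_ /subsetP lD _].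
  by apply/forall_inP => x /lD; rewrite inE => /andP[].
- rewrite exprSr -mulrA; apply: le_trans (_ : 2 ^+ M * \sum_(k < Delta.+1)
    expect (nseq k nu) G1 <= _); last by rewrite ler_pM2l ?exprn_gt0.
  apply: le_trans eL; apply: ler_sum => k _; rewrite le_eqVlt; apply/orP; left.
  by apply/eqP/expect_eq => s; rewrite /penalty big_cons mulrA.
Qed.

End Layers.

(** * Popular patterns of domination *)

Section Selection.
Variables (T : finType) (t : rel T).

(** On average a vertex of [J] dominates a third of the [4 * r] points, so at least one in twelve
    dominates [r] of them. Pigeonhole over the [2 ^ (4 * r)] patterns gives a large class dominating
    the same points. *)
Lemma popular_pattern (L : seq (T * {set T})) (J : {set T}) (r : nat) :
  (0 < r)%N -> size L = (4 * r)%N -> J != set0 ->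
  (forall l, l \in L -> (#|J| <= 3 * #|[set x in J | t x l.1]|)%N) ->
  exists (L' : seq (T * {set T})) (J' : {set T}),
  [/\ subseq L' L, (r <= size L')%N, J' \subset J,
      (#|J| <= 12 * 2 ^ (4 * r) * #|J'|)%N &
      forall x l, x \in J' -> l \in L' -> t x l.1].
Proof.
move=> r0 sL J0 dense; pose hit x := [pred l : T * {set T} | t x l.1].
pose good := [set x in J | (r <= count (hit x) L)%N].
have sumhit : (4 * r * #|J| <= 3 * \sum_(x in J) count (hit x) L)%N.
  under eq_bigr => x _ do rewrite -sum1_count big_mkcond.
  rewrite exchange_big /= big_distrr /=.
  apply: leq_trans (_ : \sum_(l <- L) #|J| <= _)%N.
    by rewrite big_const_seq count_predT iter_addn_0 sL mulnC.
  rewrite big_seq [leqRHS]big_seq; apply: leq_sum => l /dense; congr (_ <= 3 * _)%N.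
  rewrite -sum1_card big_mkcond [RHS]big_mkcond; apply: eq_bigr => x _.
  by rewrite inE; case: (x \in J); case: (t x _).
have cgood : (#|J| <= 12 * #|good|)%N.
  have : (\sum_(x in J) count (hit x) L <= r * #|J| + 4 * r * #|good|)%N.
    apply: leq_trans (_ : \sum_(x in J) (r + (x \in good) * (4 * r)) <= _)%N.
      apply: leq_sum => x xJ; rewrite inE xJ /=; have := count_size (hit x) L.
      by rewrite sL; case: leqP; lia.
    rewrite big_split /= sum_nat_const -big_distrl /= mulnC leq_add2l mulnC.
    rewrite leq_mul2l -sum1_card [leqLHS]big_mkcond [leqRHS]big_mkcond /=.
    by apply/orP; right; apply: leq_sum => x _; case: (boolP (x \in good)); rewrite !inE; case: (x \in J) => //=; move/negbTE->.
  move: sumhit; set S := (\sum_(x in J) count (hit x) L)%N.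
  by move: r0 S #|J| #|good|; clear; nia.
have [x1 x1g] : exists x, x \in good.
  by apply/set0Pn; rewrite -card_gt0; rewrite -card_gt0 in J0; lia.
pose pat x := map_tuple (fun l : T * {set T} => t x l.1) (in_tuple L).
pose class x0 := [set x in good | pat x == pat x0].
have [x0 x0g x0max] := @arg_maxnP _ x1 (mem good) (fun x => #|class x|) x1g.
have cclass : (#|good| <= 2 ^ (4 * r) * #|class x0|)%N.
  rewrite -sum1_card (partition_big pat xpredT) //=.
  rewrite (_ : 2 ^ (4 * r) = #|{: (size L).-tuple bool}|)%N; last first.
    by rewrite card_tuple card_bool sL.
  rewrite -sum_nat_const; apply: leq_sum => m _; rewrite sum1_card.
  have [x|/eq_card0->//] := pickP [pred x | (x \in good) && (pat x == m)].
  move=> /andP[xg /eqP <-]; apply: leq_trans (x0max x xg).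
  by apply/subset_leq_card/subsetP => z; rewrite [z \in class x]inE.
exists [seq l <- L | hit x0 l], (class x0); split.
- exact: filter_subseq.
- have : x0 \in good := x0g.
  by rewrite inE size_filter => /andP[].
- by apply/subsetP => x; rewrite !inE => /andP[/andP[]].
- by apply: leq_trans cgood _; rewrite -mulnA leq_mul2l.
- move=> x l; rewrite inE => /andP[_ /eqP/(congr1 val)/= patE].
  rewrite mem_filter => /andP[/= tl lL]; move/eq_in_map: patE => /(_ l lL) /= ->.
  exact: tl.
Qed.
End Selection.

(** * Uniform distributions and their mixtures *)

Section Uniform.
Variable T : finType.

Definition unif (A : {set T}) (x : T) : rat := (x \in A)%:R / #|A|%:R.

Lemma unif_ge0 A x : 0 <= unif A x.
Proof. by rewrite divr_ge0 ?ler0n. Qed.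

Lemma sum_unif A (p : pred T) :
  \sum_(x | p x) unif A x = #|[set x in A | p x]|%:R / #|A|%:R.
Proof.
rewrite -big_distrl /= -natr_sum; congr (_%:R / _).
rewrite -sum1_card big_mkcond [RHS]big_mkcond; apply: eq_bigr => x _.
by rewrite inE; case: (x \in A); case: (p x).
Qed.

Lemma sum_unif1 A : A != set0 -> \sum_x unif A x = 1.
Proof.
move=> A0; rewrite sum_unif (_ : [set x in A | xpredT x] = A) ?divff //.
  by rewrite pnatr_eq0 -lt0n card_gt0.
by apply/setP => x; rewrite inE andbT.
Qed.

(** Reference measure for the image of an in-neighbour, in the current or the next window. It uses
    all of [J], since the popular part [J'] is selected only after the layers, which depend on this
    measure. *)
Definition half_mix (D J : {set T}) (x : T) : rat := (unif D x + unif J x) / 2.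

Lemma half_mix_ge0 D J x : 0 <= half_mix D J x.
Proof. by rewrite divr_ge0 // addr_ge0 ?unif_ge0. Qed.

Lemma sum_half_mix D J : D != set0 -> J != set0 -> \sum_x half_mix D J x = 1.
Proof.
move=> D0 J0; by rewrite -big_distrl /= big_split /= !sum_unif1.
Qed.

End Uniform.

(** * Linking a window to the next one *)

Section Step.
Variables (T : finType) (t : rel T).

(* [P l] is the distribution from which the image of a vertex of level [l] is
   drawn and [B] the set of unusable tuples of images of its in-neighbours;
   these are drawn from [J'] or from the levels above [l]. *)
Definition linked (Delta w q : nat) (mu : rat) (D J J' : {set T})
    (P : nat -> T -> rat) (B : pred (seq T)) : Prop :=
  [/\ forall l x, (l < w)%N -> 0 <= P l x <= 3 ^+ (4 * (w * q)) / #|D|%:R,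
      forall l x, (l < w)%N -> 0 < P l x -> x \in D,
      forall k, (k <= Delta)%N ->
        expect (nseq k (half_mix D J)) (fun s => (B s)%:R)
        <= Delta.+1%:R * 2 ^+ (4 * (w * q)) * mu ^+ q &
      forall l s, (l < w)%N ->
        (forall z, z \in s ->
           z \in J' \/ exists2 l', (l < l' < w)%N & 0 < P l' z) ->
        ~~ B s -> mu / q%:R <= \sum_(x | all (t^~ x) s) P l x].

Lemma linked_exists (Delta w q : nat) (mu : rat) (D J : {set T}) :
  tournament t -> (0 < w)%N -> (0 < q)%N -> 0 < mu -> mu <= 1 ->
  (3 ^ (4 * (w * q)) <= #|D|)%N -> J != set0 ->
  (forall y, y \in D -> (#|J| <= 3 * #|[set x in J | t x y]|)%N) ->
  exists (J' : {set T}) P B,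
    [/\ J' \subset J, (#|J| <= 12 * 2 ^ (4 * (w * q)) * #|J'|)%N &
        linked Delta w q mu D J J' P B].
Proof.
move=> tT w0 q0 mu0 mu1 cD J0 dense.
have D0 : D != set0 by rewrite -card_gt0; apply: leq_trans cD; rewrite expn_gt0.
have [L [sL lL pL eL]] := layers tT mu0 Delta (@half_mix_ge0 _ D J) (fun=> ler01) cD.
have [|||l lin|L' [J' [sub big J'J cJ hit]]] := @popular_pattern _ t L J (w * q).
- by rewrite muln_gt0 w0.
- exact: sL.
- exact: J0.
- by have [l1 /subsetP l2 _] := lL l lin; apply/dense/l2.
pose Q l := take q (drop (l * q) L').
have QL' l : subseq (Q l) L'.
  by apply: subseq_trans (take_subseq _ _) (drop_subseq _ _).
have QL l : {subset Q l <= L}.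
  by move=> i iQ; apply: (mem_subseq sub); apply: (mem_subseq (QL' l)).
have sQ l : (l < w)%N -> size (Q l) = q.
  move=> lw; rewrite size_take size_drop; case: ltnP => // le; apply/eqP.
  rewrite eqn_leq le /=; have : (l.+1 * q <= w * q)%N by rewrite leq_mul2r lw orbT.
  by rewrite mulSn; lia.
have qR : q%:R != 0 :> rat by rewrite pnatr_eq0 -lt0n.
have qP : 0 < q%:R :> rat by rewrite ltr0n.
(* Level [l] picks a layer of its group uniformly, then a uniform vertex of the set of that
   layer. *)
pose P l x : rat := q%:R^-1 * \sum_(i <- Q l) unif i.2 x.
have P_ge0 l x : 0 <= P l x.
  by rewrite mulr_ge0 ?invr_ge0 ?ler0n // sumr_ge0 // => i _; apply: unif_ge0.
have P_gt0 l x : 0 < P l x -> exists2 i, i \in Q l & x \in i.2.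
  have [/hasP|/hasPn no] := boolP (has (fun i : T * {set T} => x \in i.2) (Q l)).
    by [].
  rewrite /P big_seq big1 ?mulr0 ?ltxx // => i /no /negbTE xi.
  by rewrite /unif xi mul0r.
have cA i : i \in L -> 0 < #|i.2|%:R :> rat.
  by case/lL => i1 _ _; rewrite ltr0n card_gt0; apply/set0Pn; exists i.1.
(* Bad hits are counted over all of [L], so one predicate serves every level and does not depend on
   the selection [L']. *)
pose B s := (q <= count (badhit t mu s) L)%N.
exists J', P, B; split=> //; split.
- move=> l x lw; rewrite P_ge0 /= /P ler_pdivrMl // -(sQ l lw).
  have sum_const c : \sum_(i <- Q l) c = (size (Q l))%:R * c.
    by rewrite big_const_seq count_predT iter_addr_0 mulr_natl.
  rewrite -sum_const big_seq [leRHS]big_seq; apply: ler_sum => i /QL iL.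
  have [_ _ lt] := lL i iL.
  apply: le_trans (_ : 1 / #|i.2|%:R <= _).
    by apply: ler_wpM2r; rewrite ?invr_ge0 ?ler0n // lern1 leq_b1.
  rewrite ler_pdivrMr ?cA // mulrAC ler_pdivlMr ?ltr0n ?card_gt0 // mul1r.
  by rewrite -natrX -natrM ler_nat sQ // ltnW.
- by move=> l x lw /P_gt0[i /QL/lL[_ /subsetP iD _] /iD].
- move=> k kD.
  have muq : 0 < mu ^+ q by rewrite exprn_gt0.
  (* Markov's inequality for the penalty. *)
  apply: le_trans (_ : mu ^+ q * expect (nseq k (half_mix D J)) (penalty t mu L) <= _).
    rewrite -expectZ; apply: expect_le; first exact/nseq_ge0/half_mix_ge0.
    move=> s; have p0 := penalty_ge0 t mu0 L s.
    case: (boolP (B s)) => Bs; last by rewrite mulr_ge0 // ltW.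
    have le := penalty_ge t mu0 L s mu1.
    rewrite mulrC -ler_pdivrMr // mul1r -exprVn; apply: le_trans le.
    by apply: ler_weXn2l => //; rewrite invf_ge1.
  rewrite mulrC ler_pM2r // mulrC.
  have e1 : \sum_(j < Delta.+1) expect (nseq j (half_mix D J)) (fun=> 1) = Delta.+1%:R.
    rewrite (eq_bigr (fun=> 1)) ?sumr_const ?card_ord // => j _.
    by rewrite expect_const ?sum_half_mix.
  rewrite e1 in eL; apply: le_trans eL.
  have kD' : (k < Delta.+1)%N by [].
  rewrite (bigD1 (Ordinal kD')) //= -[leLHS]addr0; apply: lerD.
    by rewrite le_eqVlt; apply/orP; left; apply/eqP/expect_eq => s; rewrite mul1r.
  apply: sumr_ge0 => j _; apply: expect_ge0; first exact/nseq_ge0/half_mix_ge0.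
  by move=> s; rewrite mul1r penalty_ge0.
- move=> l s lw sP nB.
  (* Vertices of [J'] dominate all points of [L']; an image for a higher level lies in the set of a
     later layer, hence dominates the points of group [l] by nesting. *)
  have Qhit i : i \in Q l -> all (t^~ i.1) s.
    move=> iQ; apply/allP => z zs; have [zJ'|[l' /andP[ll' l'w] zl']] := sP z zs.
      by apply: hit => //; apply: (mem_subseq (QL' l)).
    have [j jQ zj] := P_gt0 _ _ zl'.
    have := subseq_pairwise sub pL; rewrite -(cat_take_drop (l' * q) L').
    rewrite pairwise_cat => /and3P[/allrelP pw _ _].
    suff /pw/(_ (mem_take jQ))/forall_inP/(_ z zj) : i \in take (l' * q) L' by [].
    move: iQ; rewrite /Q take_drop => /mem_drop.
    rewrite -[take (q + _) _](@take_takel _ _ (l' * q)); first exact: mem_take.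
    by rewrite -mulSn leq_mul2r ll' orbT.
  (* Fewer than [q] layers are bad, so one of the [q] layers of the group keeps a share [mu] of its
     set, which has weight [1 / q] in [P l]. *)
  have [i iQ ibig] : exists2 i, i \in Q l & ~~ badhit t mu s i.
    have [/hasP//|] := boolP (has (predC (badhit t mu s)) (Q l)).
    rewrite has_predC negbK all_count => /eqP cQ; case/negP: nB.
    rewrite /B -(sQ l lw) -cQ; apply: leq_count_subseq.
    exact: subseq_trans (QL' l) sub.
  rewrite -big_distrr /= mulrC; apply: ler_wpM2l; first by rewrite invr_ge0 ltW.
  rewrite exchange_big /=; apply: le_trans (_ : \sum_(x | all (t^~ x) s) unif i.2 x <= _).
    rewrite sum_unif ler_pdivlMr ?(cA _ (QL _ _ iQ)) //.
    by move: ibig; rewrite /badhit Qhit //= -leNgt.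
  rewrite (big_rem _ iQ) /= lerDl; apply: sumr_ge0 => j _; apply: sumr_ge0 => x _.
  exact: unif_ge0.
Qed.
End Step.

(** * Chains along a median order *)

Section MedianOrder.
Local Open Scope nat_scope.
Variables (T : finType) (t : rel T).
Hypothesis tT : tournament t.

(** Counts the pairs whose later entry dominates the earlier one; a maximiser is a median order read
    backwards. *)
Fixpoint backward (s : seq T) : nat :=
  if s is y :: s' then (count (t^~ y) s' + backward s')%N else 0%N.

(** Pairs meeting [p] do not see the order of the tail; the additive form avoids truncated
    subtraction. *)
Lemma backward_cat p s s' : perm_eq s s' ->
  (backward (p ++ s) + backward s' = backward (p ++ s') + backward s)%N.
Proof.
move=> ss; elim: p => [|y p IH] /=; first by rewrite addnC.
by rewrite !count_cat (permP ss) -!addnA; congr (_ + (_ + _))%N.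
Qed.

Lemma backward_move y m r :
  (backward (m ++ y :: r) + count (t^~ y) m =
   backward (y :: m ++ r) + count (t y) m)%N.
Proof.
elim: m => [|x m IH] /=; first by lia.
move: IH => /=; rewrite !count_cat /=.
move: (backward _) (backward _) (count _ _) (count _ _) (count _ _) => a b c d f.
lia.
Qed.

(* A median order read backwards: every vertex has at least half of any interval
   following it as in-neighbours. *)
Lemma median_order : exists pos : T -> nat,
  [/\ forall a b (p : pred T), (b <= #|T|)%N ->
        exists2 s : seq T, size s = (b - a)%N &
          count p s = #|[set x | (a <= pos x < b)%N && p x]| &
      forall y b, (b <= #|T|)%N ->
        (b - (pos y).+1 <= 2 * #|[set x | (pos y < pos x < b)%N && t x y]|)%N].
Proof.
have [t0 tt] := tournamentP _ tT.
pose s0 : #|T|.-tuple T := enum_tuple T.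
have s0u : uniq s0 by apply: enum_uniq.
have [s su smax] := @arg_maxnP _ s0 (fun s : #|T|.-tuple T => uniq s)
  (fun s => backward s) s0u.
have cs : size s = #|T| by rewrite size_tuple.
have sT x : x \in s.
  have [||_ ->] := @uniq_min_size _ s (enum T) su; last by rewrite mem_enum.
    by move=> z; rewrite mem_enum.
  by rewrite cs cardE.
have piece a b : take (b - a) (drop a s) =i [set x | a <= index x s < b].
  move=> x; rewrite inE; case: (leqP a b) => [ab|ba]; last first.
    rewrite (eqP (ltnW ba : b - a == 0)) take0 in_nil.
    by apply/esym/negbTE; move: ba; clear; lia.
  rewrite take_drop subnK // -[RHS]andbC.
  have /(take_uniq b) tu : uniq s by [].
  have dis : {in drop a (take b s), forall z, z \notin take a s}.
    move: tu; rewrite -{1}(cat_take_drop a (take b s)) cat_uniq take_takel //.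
    by case/and3P=> _ /hasPn.
  apply/idP/andP => [xd|[xb ax]].
    have := mem_drop xd; rewrite in_take // => xb; split=> //.
    by have := dis _ xd; rewrite in_take // -leqNgt.
  have : x \in take b s by rewrite in_take.
  rewrite -{1}(cat_take_drop a (take b s)) take_takel // mem_cat in_take //.
  by rewrite ltnNge ax.
have card_piece a b (p : pred T) :
    count p (take (b - a) (drop a s)) = #|[set x | (a <= index x s < b)%N && p x]|.
  rewrite -size_filter; set f := filter _ _.
  have fu : uniq f by rewrite filter_uniq // take_uniq // drop_uniq.
  rewrite -(card_uniqP fu); apply: eq_card => x.
  by rewrite mem_filter piece !inE andbC.
exists (index^~ s); split=> [a b p bT|y b bT].
  by exists (take (b - a) (drop a s)); rewrite ?size_takel ?size_drop ?cs ?leq_sub2r.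
rewrite -card_piece; set m := take _ _; set c := count _ _.
have [le|lt] := leqP b (index y s).+1; first by lia.
have sm : size m = (b - (index y s).+1)%N.
  by rewrite size_takel // size_drop cs leq_sub2r.
pose p := take (index y s) s; pose r := drop b s.
have sE : tval s = p ++ y :: m ++ r.
  rewrite /p /m /r -[LHS](cat_take_drop (index y s)); congr (_ ++ _).
  rewrite (drop_nth y) ?index_mem // nth_index //; congr (_ :: _).
  rewrite -[LHS](cat_take_drop (b - (index y s).+1)); congr (_ ++ _).
  by rewrite drop_drop subnK // ltnW.
have perm : perm_eq (y :: m ++ r) (m ++ y :: r).
  by rewrite -cat1s perm_catCA.
have sz : size (p ++ m ++ y :: r) == #|T|.
  by rewrite -cs sE !size_cat (perm_size perm) !size_cat.
(* By maximality, moving [y] past the interval [m] does not increase [backward], so in [m] the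
   in-neighbours of [y] are at least as many as its out-neighbours. *)
have := smax (Tuple sz); rewrite /= {1}sE.
have -> : uniq (p ++ m ++ y :: r).
  by have := su; rewrite sE (perm_uniq (s2 := p ++ m ++ y :: r)) // perm_cat2l.
move=> /(_ isT) le.
have e1 := backward_cat p perm; have e2 := backward_move y m r.
have e3 : count (t y) m + c = size m.
  rewrite -(count_predC (t y) m); congr addn; rewrite /c.
  apply: eq_in_count => x xm /=.
  have xy : x != y.
    apply: contraTneq su => xy; rewrite sE cat_uniq /= mem_cat -xy xm.
    by rewrite !andbF.
  by have := tt _ _ xy; case: (t x y); case: (t y x).
rewrite -sm -e3; move: le e1 e2.
rewrite -/c; clear.
move: (backward _) (backward _) (backward _) (backward _) (count _ _).
lia.
Qed.
End MedianOrder.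

(** Finite dependent choice; the sequence is constant from stage [m] on. *)
Lemma finite_iteration (X : Type) (I : nat -> X -> Prop)
    (R : nat -> X -> X -> Prop) (m : nat) (x0 : X) :
  I 0%N x0 ->
  (forall k x, (k < m)%N -> I k x -> exists2 y, R k x y & I k.+1 y) ->
  exists f : nat -> X, forall k, (k < m)%N -> R k (f k) (f k.+1).
Proof.
move=> I0 step.
suff [f _ fR] : exists2 f : nat -> X, I m (f m) &
    forall k, (k < m)%N -> R k (f k) (f k.+1) by exists f.
elim: m step => [|m IH] step; first by exists (fun=> x0).
have [k x km|f fI fR] := IH; first exact/step/ltnW.
have [y yR yI] := step m (f m) (ltnSn m) fI.
exists (fun k => if (k <= m)%N then f k else y) => [|k]; first by rewrite ltnn.
rewrite ltnS => le; have /predU1P[->|km] : (k == m) || (k < m)%N by rewrite -leq_eqVlt.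
  by rewrite /= leqnn ltnn.
by rewrite /= km le; apply: fR.
Qed.

(** * Successive windows of the median order *)

Section Chain.
Variables (T : finType) (t : rel T) (pos : T -> nat).
Hypothesis tT : tournament t.

Definition window (a s : nat) : {set T} := [set x | (a <= pos x < a + s)%N].

Hypothesis card_pos : forall a b, (b <= #|T|)%N ->
  #|[set x | (a <= pos x < b)%N]| = (b - a)%N.
Hypothesis median : forall y b, (b <= #|T|)%N ->
  (b - (pos y).+1 <= 2 * #|[set x | (pos y < pos x < b)%N && t x y]|)%N.

Lemma card_window a s : (a + s <= #|T|)%N -> #|window a s| = s.
Proof. by move=> aT; rewrite card_pos // addKn. Qed.

Lemma card_blocks (p : pred T) (a s n : nat) :
  (#|[set x | (a <= pos x < a + n * s)%N && p x]| <=
   \sum_(j < n) #|[set x in window (a + j * s) s | p x]|)%N.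
Proof.
elim: n => [|n IH].
  rewrite big_ord0 leqn0 cards_eq0; apply/eqP/setP => x; rewrite !inE.
  by apply/negbTE; lia.
rewrite big_ord_recr /=; apply: leq_trans (leq_add IH (leqnn _)).
apply: leq_trans (leq_card_setU _ _); apply/subset_leq_card/subsetP => x.
rewrite !inE mulSn => /andP[/andP[ax xb] ->]; rewrite !andbT ax /=.
by case: ltnP => //= xn; move: xb; clear; lia.
Qed.

(** Averaging over windows that tile a stretch of length at least [5 * s] finds one dominating [D]
    with mean density 2/5; as 2/5 = 1/3 + (1/10) * (2/3), a tenth of [D] sees density 1/3. *)
Lemma next_window (a s s' : nat) (D : {set T}) :
  (0 < s)%N -> (0 < s')%N -> D \subset window a s ->
  (a + s + (5 * s + s') <= #|T|)%N ->
  exists a' (D' : {set T}),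
    [/\ (a + s <= a')%N, (a' + s' <= a + s + (5 * s + s'))%N, D' \subset D,
        (#|D| <= 10 * #|D'|)%N &
        forall y, y \in D' ->
          (s' <= 3 * #|[set x in window a' s' | t x y]|)%N].
Proof.
move=> s0 s'0 /subsetP DI NT; set b := (a + s)%N in NT *.
pose n := ((5 * s) %/ s').+1.
have n1 : (5 * s <= n * s')%N by rewrite ltnW // ltn_ceil.
have n2 : (n * s' <= 5 * s + s')%N by rewrite /n [(_.+1 * s')%N]mulSn [leqLHS]addnC leq_add2r leq_trunc_div.
pose d y j := #|[set x in window (b + j * s') s' | t x y]|.
(* At least half of the interval after [y] dominates [y], and fewer than [s] of its positions
   precede [b]; since [n * s' >= 5 * s], this leaves 2/5 of the tiled stretch. *)
have dense y : y \in D -> (2 * n * s' <= 5 * \sum_(j < n) d y j)%N.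
  move=> /DI; rewrite inE -/b => /andP[ay yb].
  have bT : (b + n * s' <= #|T|)%N by lia.
  pose c := #|[set x | (b <= pos x < b + n * s')%N && t x y]|.
  have blocks : (c <= \sum_(j < n) d y j)%N := card_blocks (fun x => t x y) b s' n.
  have := median y bT; set c' := #|_|.
  have : (c' <= #|[set x | ((pos y).+1 <= pos x < b)%N]| + c)%N.
    apply: leq_trans (leq_card_setU _ _); apply/subset_leq_card/subsetP => x.
    rewrite !inE => /andP[/andP[-> ->] ->] /=; rewrite !andbT.
    by case: (ltnP (pos x) b).
  rewrite card_pos; last by move: bT; clear; lia.
  move: n1 ay yb blocks; rewrite /b -mulnA; clear.
  move: (\sum_(_ < n) _)%N (pos y) c c' (n * s')%N => ? ? ? ? ?; lia.
have [j jbig] : exists j : 'I_n, (2 * s' * #|D| <= 5 * \sum_(y in D) d y j)%N.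
  apply/existsP; apply: contraT => /existsPn no; exfalso.
  have : (\sum_(j < n) 5 * \sum_(y in D) d y j < \sum_(j < n) 2 * s' * #|D|)%N.
    rewrite big_ord_recl [ltnRHS]big_ord_recl -addSn; apply: leq_add.
      by have := no ord0; rewrite -ltnNge.
    by apply: leq_sum => j _; have := no (lift ord0 j); rewrite -ltnNge => /ltnW.
  rewrite sum_nat_const card_ord -big_distrr exchange_big /= big_distrr /=.
  rewrite ltnNge => /negP; apply.
  rewrite mulnA [(n * _)%N]mulnA [(n * 2)%N]mulnC mulnC -sum_nat_const.
  exact: leq_sum.
exists (b + j * s')%N, [set y in D | (s' <= 3 * d y j)%N].
have jn : (j.+1 * s' <= n * s')%N by rewrite leq_mul2r ltn_ord orbT.
have jT : (b + j * s' + s' <= b + n * s')%N by rewrite -addnA leq_add2l addnC -mulSn.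
split.
- exact: leq_addr.
- by apply: leq_trans jT _; rewrite leq_add2l.
- by apply/subsetP => y; rewrite inE => /andP[].
- set D' := [set y in D | _].
  have dle y : (d y j <= s')%N.
    rewrite -[leqRHS](@card_window (b + j * s')); last first.
      by apply: leq_trans jT _; lia.
    by apply/subset_leq_card/subsetP => x; rewrite inE => /andP[].
  have : (\sum_(y in D) 3 * d y j <= s' * #|D| + 2 * s' * #|D'|)%N.
    apply: leq_trans (_ : \sum_(y in D) (s' + (y \in D') * (2 * s')) <= _)%N.
      apply: leq_sum => y yD; rewrite inE yD /=; have := dle y.
      by case: leqP; move: (d y j) => c; clear; lia.
    rewrite big_split /= sum_nat_const -big_distrl /= mulnC leq_add2l mulnC.
    rewrite leq_mul2l -sum1_card [leqLHS]big_mkcond [leqRHS]big_mkcond /=.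
    apply/orP; right; apply: leq_sum => y _; rewrite inE.
    by case: (y \in D) => //=; case: leq.
  rewrite -big_distrr /=; move: jbig s'0; clear.
  move: (\sum_(y in D) d y j)%N #|D| #|D'| => c f g; nia.
- by move=> y; rewrite inE => /andP[].
Qed.

(** Alternates [next_window] and [linked_exists]. Their losses 10 and [12 * 2 ^ (4 * (w * q))]
    multiply to the bound on [#|D' k|], and each step advances by at most [5 * s k + s k.+1]
    positions. *)
Lemma chain (Delta w q : nat) (mu : rat) (s : nat -> nat) (m : nat) :
  (0 < w)%N -> (0 < q)%N -> 0 < mu -> mu <= 1 ->
  (forall k, 120 * 6 ^ (4 * (w * q)) <= s k)%N ->
  (s 0 + \sum_(k < m) (5 * s k + s k.+1) <= #|T|)%N ->
  exists (D D' : nat -> {set T}) (P : nat -> nat -> T -> rat)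
         (B : nat -> pred (seq T)) (a : nat -> nat),
  forall k, (k < m)%N ->
    [/\ D' k \subset window (a k) (s k), (a k + s k <= a k.+1)%N,
        (s k <= 120 * 2 ^ (4 * (w * q)) * #|D' k|)%N,
        #|window (a k.+1) (s k.+1)| = s k.+1 /\ D' k \subset D k &
        linked t Delta w q mu (D' k) (window (a k.+1) (s k.+1)) (D k.+1)
          (P k) (B k)].
Proof.
move=> w0 q0 mu0 mu1 sbig NT; set M := (4 * (w * q))%N in sbig *.
pose X := (nat * {set T} * {set T} * (nat -> T -> rat) * pred (seq T))%type.
(* The fields [D'_], [P_] and [B_] of a state describe the window before that of [D_]: they are
   known only once the next window is found. *)
pose a_ (x : X) := x.1.1.1.1; pose D_ (x : X) := x.1.1.1.2.
pose D'_ (x : X) := x.1.1.2; pose P_ (x : X) := x.1.2; pose B_ (x : X) := x.2.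
have s0 k : (0 < s k)%N.
  by apply: leq_trans (sbig k); rewrite muln_gt0 expn_gt0.
pose I k (x : X) := [/\ D_ x \subset window (a_ x) (s k),
  (s k <= 12 * 2 ^ M * #|D_ x|)%N &
  (a_ x + s k <= s 0 + \sum_(j < k) (5 * s j + s j.+1))%N].
pose R k (x y : X) := 
    [/\ D'_ y \subset window (a_ x) (s k), (a_ x + s k <= a_ y)%N,
        (s k <= 120 * 2 ^ M * #|D'_ y|)%N,
        #|window (a_ y) (s k.+1)| = s k.+1 /\ D'_ y \subset D_ x &
        linked t Delta w q mu (D'_ y) (window (a_ y) (s k.+1)) (D_ y) (P_ y) (B_ y)].
(* The first candidate set is a whole window; the last three components are placeholders. *)
pose x0 : X := (0%N, window 0 (s 0%N), set0, fun=> fun=> 0, xpred0).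
have [|k x km [xD xs xa]|f fR] := @finite_iteration X I R m x0.
- split; rewrite /x0 /D_ /a_ /= ?big_ord0 ?addn0 //.
  rewrite card_window; first by rewrite leq_pmull // muln_gt0 expn_gt0.
  by apply: leq_trans NT; rewrite leq_addr.
- have le : (\sum_(j < k.+1) (5 * s j + s j.+1) <= \sum_(j < m) (5 * s j + s j.+1))%N.
    rewrite -!(big_mkord xpredT (fun j => 5 * s j + s j.+1)%N).
    by rewrite [leqRHS](big_cat_nat (n := k.+1)) //= leq_addr.
  have bd : (a_ x + s k + (5 * s k + s k.+1) <= s 0 + \sum_(j < k.+1) (5 * s j + s j.+1))%N.
    by rewrite big_ord_recr /= [leqRHS]addnA leq_add2r.
  have NT' := leq_trans (leq_add (leqnn (s 0%N)) le) NT.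
  have [a' [D' [aa' a'N D'D cD dense]]] :=
    next_window (s0 k) (s0 k.+1) xD (leq_trans bd NT').
  have cJ : #|window a' (s k.+1)| = s k.+1.
    by apply: card_window; apply: leq_trans a'N (leq_trans bd NT').
  have sD' : (s k <= 120 * 2 ^ M * #|D'|)%N.
    apply: leq_trans xs _; apply: leq_trans (_ : 12 * 2 ^ M * (10 * #|D'|) <= _)%N.
      by rewrite leq_mul2l cD orbT.
    by clear; move: (2 ^ M)%N => c; lia.
  have [|||J' [P [B [J'J cJ' lk]]]] :=
    @linked_exists _ t Delta w q mu D' (window a' (s k.+1)) tT w0 q0 mu0 mu1.
  (* Hence [3 ^ M <= #|D'|], enough for [M] nested layers. *)
  + have := leq_trans (sbig k) sD'.
    rewrite -[6%N]/(2 * 3)%N expnMn mulnA leq_mul2l.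
    by rewrite muln_eq0 expn_eq0.
  + by rewrite -card_gt0 cJ.
  + by move=> y yD; rewrite cJ; apply: dense.
  exists (a', J', D', P, B); split; rewrite /a_ /D_ /D'_ /P_ /B_ //=.
  + exact: subset_trans D'D xD.
  + by rewrite -[X in (X <= _)%N]cJ.
  + exact: leq_trans a'N bd.
exists (fun k => D_ (f k)), (fun k => D'_ (f k.+1)),
  (fun k => P_ (f k.+1)), (fun k => B_ (f k.+1)), (fun k => a_ (f k)).
by move=> k /fR[? ? ? [? ?] ?]; split.
Qed.

End Chain.

(** * Depth and numerical bounds *)

(* Depth is counted from the last part, and empty parts are skipped. *)
Lemma compressed_depth (V : finType) (e : rel V) (w : nat) :
  graded_bandwidth_le e w -> exists depth : V -> nat,
    (forall u v, e u v -> (depth v < depth u <= depth v + w)%N) /\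
    (forall u d, (d <= depth u)%N -> exists v, depth v = d).
Proof.
move=> [H [h hP]]; pose C := h @: [set: V].
have hC v : h v \in C by apply: imset_f.
pose above v := [set i in C | (h v < i)%N].
exists (fun v => #|above v|); split=> [u v /hP uv|u].
  have ->: above u = above v :|: [set i in C | (h u < i <= h v)%N].
    apply/setP => i; rewrite !inE; case: (i \in C) => //=.
    by move: uv; clear; lia.
  rewrite cardsU (_ : _ :&: _ = set0) ?cards0 ?subn0; last first.
    by apply/setP => i; rewrite !inE; apply/negbTE; clear; lia.
  rewrite -[X in (X < _)%N]addn0 ltn_add2l leq_add2l card_gt0; apply/andP; split.
    by apply/set0Pn; exists (h v); rewrite inE hC leqnn andbT; move: uv; clear; lia.
  apply: leq_trans (_ : (h v - h u <= w)%N); last by case/andP: uv.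
  rewrite cardE -(size_map val) -[leqRHS](size_iota (h u).+1).
  apply: uniq_leq_size; first by rewrite map_inj_uniq ?enum_uniq //; apply: val_inj.
  move=> _ /mapP[i + ->]; rewrite mem_enum inE mem_iota => /andP[_].
  by move: uv => /=; clear; lia.
move: {2}#|above u| (erefl #|above u|) => n; elim: n u => [|n IH] u un d.
  by rewrite un leqn0 => /eqP ->; exists u.
rewrite un leq_eqVlt => /predU1P[->|]; first by exists u.
have [i0 i0u] : exists i, i \in above u by apply/set0Pn; rewrite -card_gt0 un.
(* The first non-empty part after that of [u] has depth one less, so no depth is skipped. *)
have [i iu imin] := @arg_minnP _ i0 (mem (above u)) val i0u.
have iu' : i \in above u := iu.
have := iu'; rewrite inE => /andP[/imsetP[v _ iv] ui].
suff vn : #|above v| = n by rewrite ltnS -vn; apply: IH.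
apply/eqP; rewrite -eqSS -un (cardsD1 i (above u)) iu' add1n eqSS; apply/eqP.
apply: eq_card => j; rewrite !inE -iv; case jC : (j \in C); rewrite ?andbF //=.
have : j \in above u -> (i <= j)%N := imin j; rewrite inE jC /= -(inj_eq val_inj) /=.
by move: ui; clear; move=> a /= b; apply/idP/idP; lia.
Qed.

(** From [6 ^ 4 = 1296 <= 2187 = 3 ^ 7]. *)
Lemma exp6_le_exp3 n : (6 ^ (8 * n) <= 3 ^ (14 * n))%N.
Proof.
have -> : (8 * n = 4 * (2 * n))%N by lia.
have -> : (14 * n = 7 * (2 * n))%N by lia.
rewrite (expnM 6) (expnM 3); case: n => [|n]; first by rewrite muln0.
by rewrite leq_exp2r // muln_gt0.
Qed.

(** Gives [P_spread] for windows of [3 ^ (50 * n)] positions per vertex: 50 = 6 + 14 + 1 + 29, with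
    [720 <= 3 ^ 6]. *)
Lemma spread_bound (n Delta : nat) : (0 < n)%N -> (Delta <= n)%N ->
  (120 * 6 ^ (8 * n) * (6 * Delta) * 3 ^ (29 * n) <= 3 ^ (50 * n))%N.
Proof.
move=> n0 Dn.
have -> : (3 ^ (50 * n) = 3 ^ (6 * n) * 3 ^ (14 * n) * 3 ^ n * 3 ^ (29 * n))%N.
  by rewrite -!expnD; congr expn; lia.
rewrite leq_mul2r; apply/orP; right.
rewrite (_ : 120 * 6 ^ (8 * n) * (6 * Delta) = 720 * 6 ^ (8 * n) * Delta)%N; last first.
  by clear; move: (6 ^ (8 * n))%N => c; lia.
apply: leq_mul; last exact: leq_trans Dn (ltnW (ltn_expl _ _)).
apply: leq_mul; last exact: exp6_le_exp3.
by apply: leq_trans (_ : 3 ^ 6 <= _)%N => //; rewrite leq_exp2l // leq_pmulr.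
Qed.

Lemma sqr_le_exp3 n : (n ^ 2 <= 3 ^ n)%N.
Proof.
elim: n => // -[|[|n]] // IH; rewrite [leqRHS]expnS.
by apply: leq_trans (leq_mul (leqnn 3) IH); rewrite -!mulnn; clear; nia.
Qed.

(** Source of the exponent of [1 / mu]: 29 = 8 + 14 + 6 + 1 pays in turn for 2880, the power of 6,
    the power of 2 and [Delta ^ 2]. *)
Lemma bad_bound (w Delta : nat) : (0 < w)%N -> (0 < Delta)%N ->
  (2880 * 6 ^ (8 * (Delta * w)) * 2 ^ (8 * w) * Delta ^ 2
   < 3 ^ (29 * (Delta * w)))%N.
Proof.
move=> w0 D0; set n := (Delta * w)%N.
have n0 : (0 < n)%N by rewrite muln_gt0 D0.
have -> : (3 ^ (29 * n) = 3 ^ (8 * n) * 3 ^ (14 * n) * 3 ^ (6 * n) * 3 ^ n)%N.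
  by rewrite -!expnD; congr expn; lia.
apply: leq_ltn_trans (_ : 2880 * 3 ^ (14 * n) * 3 ^ (6 * n) * 3 ^ n < _)%N.
  apply: leq_mul; last first.
    by apply: leq_trans (sqr_le_exp3 _) _; rewrite leq_exp2l // leq_pmulr.
  apply: leq_mul; first by rewrite leq_mul2l exp6_le_exp3 orbT.
  apply: leq_trans (_ : 3 ^ (6 * w) <= _)%N; first by rewrite !expnM leq_exp2r.
  by rewrite leq_exp2l // leq_mul2l leq_pmull.
rewrite !ltn_pmul2r ?expn_gt0 //.
by apply: leq_trans (_ : 3 ^ 8 <= _)%N => //; rewrite leq_exp2l // leq_pmulr.
Qed.

(** This is [eps * K ^+ Delta < 1] for the final parameters. Groups of [2 * Delta] layers leave a
    factor [mu ^+ Delta] after the divisions in [K]; then all is a [Delta]-th power but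
    [Delta.+1 <= 2 ^ Delta]. *)
Lemma expr_mixture_bound (Delta w : nat) (mu : rat) :
  (0 < Delta)%N -> (0 < w)%N -> mu = (3 ^ (29 * (Delta * w)))%:R^-1 ->
  (240 * 6 ^ (8 * (Delta * w)))%:R ^+ Delta *
  (Delta.+1%:R * 2 ^+ (8 * (Delta * w)) * mu ^+ (2 * Delta)) *
  ((6 * Delta ^ 2)%:R / mu) ^+ Delta < 1 :> rat.
Proof.
move=> D0 w0 muE.
have mu0 : 0 < mu by rewrite muE invr_gt0 ltr0n expn_gt0.
set a := (240 * _)%N; set b := (6 * _)%N.
have -> : a%:R ^+ Delta * (Delta.+1%:R * 2 ^+ (8 * (Delta * w)) * mu ^+ (2 * Delta)) *
    (b%:R / mu) ^+ Delta = Delta.+1%:R * (a%:R * 2 ^+ (8 * w) * mu * b%:R) ^+ Delta.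
  rewrite (_ : 8 * (Delta * w) = 8 * w * Delta)%N; last by lia.
  rewrite [2 ^+ _]exprM [mu ^+ _]exprM expr_div_n !exprMn.
  have := expf_neq0 Delta (lt0r_neq0 mu0).
  by move: (mu ^+ Delta) => m m0; field.
set X := a%:R * _ * mu * _.
have X0 : 0 <= X by rewrite !mulr_ge0 ?ler0n ?exprn_ge0 // ltW.
apply: le_lt_trans (_ : (2 * X) ^+ Delta < 1).
  rewrite (exprMn _ 2); apply: ler_wpM2r; first by rewrite exprn_ge0.
  by rewrite -natrX ler_nat ltn_expl.
have big := bad_bound w0 D0.
rewrite (expr_lt1 D0 (mulr_ge0 (ler0n _ 2) X0)).
have -> : 2 * X = 2 * a%:R * 2 ^+ (8 * w) * b%:R * mu by rewrite /X; ring.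
rewrite muE ltr_pdivrMr ?ltr0n ?expn_gt0 //.
rewrite mul1r; apply: le_lt_trans (_ : (2880 * 6 ^ (8 * (Delta * w)) * 2 ^ (8 * w) * Delta ^ 2)%:R < _).
  by rewrite /a /b -!natrX -!natrM ler_nat; clear; lia.
by rewrite ltr_nat.
Qed.

Lemma block_step (w x y : nat) : (0 < w)%N -> (y < x <= y + w)%N ->
  ((x %/ w = y %/ w /\ y %% w < x %% w) \/ x %/ w = (y %/ w).+1)%N.
Proof.
move=> w0; have := ltn_pmod y w0; have := ltn_pmod x w0.
have := divn_eq x w; have := divn_eq y w.
move: (x %/ w)%N (y %/ w)%N (x %% w)%N (y %% w)%N => a b c d -> -> cw dw.
move=> /andP[l1 l2]; have [ab|ab|ab] := ltngtP a b.
- by have := leq_mul ab (leqnn w); lia.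
- right; apply/eqP; rewrite eqn_leq ab andbT leqNgt; apply/negP => ab2.
  by have := leq_mul ab2 (leqnn w); lia.
- by left; split=> //; rewrite ab ltn_add2l in l1.
Qed.

(** * Choice of parameters and assembly *)

Lemma graded_bandwidth_forces (Delta w : nat) (V : finType) (e : rel V) :
  max_degree e = Delta -> graded_bandwidth_le e w ->
  forces e (3 ^ (57 * Delta * w) * #|V|).
Proof.
move=> hDelta hw.
have degD v : (degree e v <= Delta)%N by rewrite -hDelta; apply: leq_bigmax.
apply/forcesP => T t cT tT.
(* Without edges any injection is a copy; an edge makes [Delta] and [w] positive. *)
have [/existsP[u /existsP[v uv]]|noe] := boolP [exists u, exists v, e u v]; last first.
  have VT : (#|V| <= #|T|)%N by rewrite cT leq_pmull // expn_gt0.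
  apply/contains_copyP; exists (fun v => enum_val (widen_ord VT (enum_rank v))).
    by move=> u v /enum_val_inj /(congr1 val) /= /ord_inj /enum_rank_inj.
  by move=> u v uv; case/negP: noe; apply/existsP; exists u; apply/existsP; exists v.
have D0 : (0 < Delta)%N.
  by apply: leq_trans (degD u); apply/card_gt0P; exists v; rewrite inE uv orbT.
have w0 : (0 < w)%N.
  by have [H [h hP]] := hw; have /andP[a b] := hP u v uv; apply: leq_trans a b.
have x0 : T.
  suff /card_gt0P/sigW[x _] : (0 < #|T|)%N by [].
  by rewrite cT muln_gt0 expn_gt0 /=; apply/card_gt0P; exists u.
have V0 : (0 < #|V|)%N by apply/card_gt0P; exists u.
clear u v uv; pose n := (Delta * w)%N.
have n0 : (0 < n)%N by rewrite muln_gt0 D0.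
have Dn : (Delta <= n)%N by rewrite leq_pmulr.
have [depth [depthE depth_onto]] := compressed_depth hw.
pose part v := (depth v %/ w)%N; pose lev v := (depth v %% w)%N.
have levw v : (lev v < w)%N by rewrite ltn_mod.
have edge_part u v : e u v ->
    (part u = part v /\ (lev v < lev u)%N) \/ part u = (part v).+1.
  by move=> /depthE; apply: block_step.
pose m := (\max_v part v).+1; have part_lt v : (part v < m)%N.
  by rewrite ltnS; apply: leq_bigmax.
pose U k := #|[pred u | part u == k]|.
have U_gt0 k : (k < m)%N -> (0 < U k)%N.
  have [v1 v1max] := bigop.eq_bigmax part V0.
  rewrite /m v1max ltnS => kv1.
  have [v vk] := depth_onto v1 (k * w)%N (leq_trans (leq_mul kv1 (leqnn w)) (leq_trunc_div _ _)).
  by apply/card_gt0P; exists v; rewrite inE /part vk mulnK.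
(* The maximum with 1 gives length to the window of the empty block [m], needed by the last step of
   the chain. *)
pose s k := (3 ^ (50 * n) * maxn 1 (U k))%N.
pose M := (4 * (w * (2 * Delta)))%N.
have ME : M = (8 * n)%N by rewrite /M /n; lia.
pose mu : rat := (3 ^ (29 * n))%:R^-1.
have mu0 : 0 < mu by rewrite invr_gt0 ltr0n expn_gt0.
have mu1 : mu <= 1 by rewrite invf_le1 ?ler1n ?ltr0n expn_gt0.
have [pos [card_pos median]] := median_order tT.
have card_pos' a b : (b <= #|T|)%N -> #|[set x | (a <= pos x < b)%N]| = (b - a)%N.
  move=> bT; have [l <- ] := card_pos a b xpredT bT; rewrite count_predT => ->.
  by apply: eq_card => x; rewrite !inE andbT.
have spread := spread_bound n0 Dn.
have sbig k : (120 * 6 ^ M <= s k)%N.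
  rewrite ME; apply: leq_trans (_ : 3 ^ (50 * n) <= _)%N; last first.
    by rewrite leq_pmulr // leq_max.
  apply: leq_trans spread; rewrite -mulnA leq_pmulr //.
  by rewrite !muln_gt0 D0 expn_gt0.
have s_U k : (k < m)%N -> s k = (3 ^ (50 * n) * U k)%N.
  by move=> km; rewrite /s (maxn_idPr (U_gt0 k km)).
have sumU : (\sum_(k < m) U k = #|V|)%N.
  rewrite -sum1_card (partition_big (fun v => Ordinal (part_lt v)) xpredT) //=.
  by apply: eq_bigr => k _; rewrite sum1_card.
(* The total is at most [7 * 3 ^ (50 * n) * #|V|], and [7 <= 3 ^ (7 * n)] completes the exponent
   57. *)
have budget : (s 0 + \sum_(k < m) (5 * s k + s k.+1) <= #|T|)%N.
  have sumS : (\sum_(k < m) s k = 3 ^ (50 * n) * #|V|)%N.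
    rewrite -sumU big_distrr /=; apply: eq_bigr => k _.
    by rewrite s_U.
  have sm : s m = (3 ^ (50 * n))%N.
    rewrite /s /U (eq_card0 (A := [pred u | part u == m])) ?muln1 // => u.
    by rewrite !inE ltn_eqF.
  have -> : (s 0 + \sum_(k < m) (5 * s k + s k.+1) =
      5 * \sum_(k < m) s k + \sum_(k < m.+1) s k)%N.
    by rewrite big_split /= -big_distrr /= [X in _ = (_ + X)%N]big_ord_recl addnCA.
  rewrite [X in (_ + X)%N]big_ord_recr /= sumS sm cT (_ : 57 * Delta * w = 7 * n + 50 * n)%N; last first.
    by rewrite /n; lia.
  rewrite expnD -mulnA; move: (3 ^ (50 * n))%N => c.
  have le7 : (7 <= 3 ^ (7 * n))%N.
    apply: leq_trans (_ : 3 ^ 7 <= _)%N; last by rewrite leq_exp2l // leq_pmulr.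
    by [].
  apply: leq_trans (leq_mul le7 (leqnn _)).
  have := leq_pmulr c V0; move: (c * #|V|)%N => d; clear; lia.
clearbody s.
have q0 : (0 < 2 * Delta)%N by rewrite muln_gt0.
have [D [D' [P [B [a chainP]]]]] :=
  chain tT card_pos' median Delta w0 q0 mu0 mu1 sbig budget.
pose Pv v := P (part v) (lev v); pose Bv v := B (part v).
pose R : rat := (240 * 6 ^ (8 * n))%:R.
have Pv_ge0 v x : 0 <= Pv v x.
  by have [_ _ _ _ [H _ _ _]] := chainP _ (part_lt v); case/andP: (H _ x (levw v)).
have Pv_le v x : Pv v x <= 3 ^+ M / #|D' (part v)|%:R.
  by have [_ _ _ _ [H _ _ _]] := chainP _ (part_lt v); case/andP: (H _ x (levw v)).
have Pv_supp v x : 0 < Pv v x -> x \in D' (part v).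
  by have [_ _ _ _ [_ H _ _]] := chainP _ (part_lt v); apply: H.
have disj k k' x : (k < k')%N -> (k' < m)%N -> x \in D' k -> x \in D' k' -> False.
  move=> kk' k'm; have ord j : (k < j)%N -> (j < m)%N -> (a k + s k <= a j)%N.
    elim: j => // j IH; rewrite ltnS leq_eqVlt => /predU1P[<-|kj] jm.
      by have [_ H _ _ _] := chainP k (ltnW jm).
    apply: leq_trans (IH kj (ltnW jm)) _.
    by have [_ H _ _ _] := chainP j (ltnW jm); apply: leq_trans H; apply: leq_addr.
  have [/subsetP H1 _ _ _ _] := chainP k (ltn_trans kk' k'm).
  have [/subsetP H2 _ _ _ _] := chainP k' k'm.
  move=> /H1 + /H2; rewrite !inE => /andP[_ lt] /andP[le _].
  by have := leq_trans lt (leq_trans (ord k' kk' k'm) le); rewrite ltnn.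
have D'_gt0 k : (k < m)%N -> 0 < #|D' k|%:R :> rat.
  move=> km; have [_ _ H _ _] := chainP k km; rewrite ltr0n lt0n.
  apply: contraTneq H => ->; rewrite muln0 -ltnNge; apply: leq_trans (sbig k).
  by rewrite muln_gt0 expn_gt0.
have s_le k : (k < m)%N -> (s k)%:R <= 120 * 2 ^+ M * #|D' k|%:R :> rat.
  by move=> km; have [_ _ H _ _] := chainP k km; rewrite -natrX -!natrM ler_nat.
(* In the same block [Pv u] is compared with the uniform half on [D'], in the next block with the
   half on the full window [J], at most [120 * 2 ^ M] times larger than [D'] there; halving doubles
   120 to 240. *)
have dominated u v x : e u v ->
    Pv u x <= R * half_mix (D' (part v)) (window pos (a (part v).+1) (s (part v).+1)) x.
  move=> uv; set J := window _ _ _.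
  have [Pux|Pux] := leP (Pv u x) 0.
    by apply: le_trans Pux _; rewrite mulr_ge0 ?ler0n ?half_mix_ge0.
  have xu := Pv_supp _ _ Pux; apply: le_trans (Pv_le u x) _.
  have RE : R = 240 * 2 ^+ M * 3 ^+ M.
    by rewrite /R -ME -[6%N]/(2 * 3)%N expnMn !natrM !natrX mulrA.
  rewrite RE /half_mix; have [Du Jx] := (D'_gt0 _ (part_lt u), unif_ge0 J x).
  have M2 : 1 <= 2 ^+ M :> rat by apply: exprn_ege1.
  have M3 : 0 < 3 ^+ M :> rat by apply: exprn_gt0.
  have [[uvE _]|uvE] := edge_part _ _ uv.
    have : unif (D' (part v)) x = #|D' (part u)|%:R^-1.
      by rewrite /unif -uvE xu mul1r.
    have : 0 < #|D' (part u)|%:R^-1 :> rat by rewrite invr_gt0.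
    move: #|_|%:R^-1 (unif (D' _) x) (unif J x) (2 ^+ M) (3 ^+ M) M2 M3 Jx => i ? j p r.
    move=> p1 r0 j0 i0 ->; rewrite -subr_ge0.
    have -> : 240 * p * r * ((i + j) / 2) - r * i = r * (i * (120 * p - 1) + 120 * p * j).
      by field.
    apply: mulr_ge0; first exact: ltW.
    by apply: addr_ge0; apply: mulr_ge0; lra.
  have um : ((part v).+1 < m)%N by rewrite -uvE.
  have [/subsetP DJ _ _ _ _] := chainP _ um.
  have cJ : #|J| = s (part u).
    by rewrite uvE; have [_ _ _ [H _] _] := chainP _ (part_lt v).
  have JE : unif J x = (s (part u))%:R^-1.
    have xJ : x \in J by apply: DJ; rewrite -uvE.
    by rewrite /unif xJ cJ mul1r.
  have sP : 0 < (s (part u))%:R :> rat.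
    by rewrite ltr0n; apply: leq_trans (sbig _); rewrite muln_gt0 expn_gt0.
  rewrite JE; apply: le_trans (_ : 240 * 2 ^+ M * 3 ^+ M * ((s (part u))%:R^-1 / 2) <= _).
    have := s_le _ (part_lt u).
    move: (s _)%:R #|_|%:R (2 ^+ M) (3 ^+ M) sP Du M2 M3 => c d p r c0 d0 p1 r0 le.
    have -> : 240 * p * r * (c^-1 / 2) = r * (120 * p) / c.
      by field; apply: lt0r_neq0.
    rewrite (ler_pdivrMr _ _ d0) mulrAC (ler_pdivlMr _ _ c0) -mulrA.
    by rewrite (ler_pM2l r0).
  apply: ler_wpM2l.
    apply: mulr_ge0 _ (ltW M3); apply: mulr_ge0 _ (le_trans ler01 M2).
    exact: ler0n.
  by apply: ler_wpM2r; [rewrite invr_ge0 ler0n | rewrite lerDr unif_ge0].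
have [f fI fe] : exists2 f : V -> T, injective f & {homo f : u v / e u v >-> t u v}.
  have R1 : 1 <= R by rewrite ler1n muln_gt0 expn_gt0.
  have DR : 0 < Delta%:R :> rat by rewrite ltr0n.
  have indegD v : (#|[pred u | e u v]| <= Delta)%N.
    apply: leq_trans (degD v); apply/subset_leq_card/subsetP => u.
    by rewrite !inE => ->.
  (* [K] makes [Delta / K] equal to [eta = mu / (6 * Delta)]; the sum [mu / (3 * Delta)] is below
     [eta' = mu / (2 * Delta)]. *)
  apply: (@random_greedy_embedding V T e t depth part Pv Bv Delta
    (R ^+ Delta * (Delta.+1%:R * 2 ^+ M * mu ^+ (2 * Delta)))
    ((6 * Delta ^ 2)%:R / mu) (mu / (6 * Delta)%:R) (mu / (2 * Delta)%:R)) => //.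
  - by move=> u v /depthE/andP[].
  - move=> u; apply: leq_trans (degD u); apply/subset_leq_card/subsetP => v.
    by rewrite !inE => ->; rewrite orbT.
  - move=> u v x /Pv_supp xu /Pv_supp xv.
    have [lt|lt|//] := ltngtP (part u) (part v).
      by case: (disj _ _ x lt).
    by case: (disj _ _ x lt).
  - move=> v x; rewrite -/(U (part v)); apply: le_trans (_ : 3 ^+ M / #|D' (part v)|%:R * (U (part v))%:R <= _).
      by apply: ler_wpM2r; rewrite ?ler0n.
    have := D'_gt0 _ (part_lt v); have [_ _ + _ _] := chainP _ (part_lt v).
    rewrite (s_U _ (part_lt v)) -/M.
    move: (U _) #|_| => c d le d0.
    have z0 : 0 < (3 ^ (29 * n))%:R :> rat by rewrite ltr0n expn_gt0.
    have D6 : 0 < (6 * Delta)%:R :> rat by rewrite ltr0n muln_gt0.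
    rewrite [leLHS]mulrAC (ler_pdivrMr _ _ d0) [leRHS]mulrAC (ler_pdivlMr _ _ D6).
    rewrite [leRHS]mulrC (ler_pdivlMr _ _ z0) -natrX -!natrM ler_nat.
    rewrite -(@leq_pmul2l (3 ^ (50 * n))) ?expn_gt0 //.
    apply: leq_trans (leq_mul spread (leqnn d)); rewrite -ME.
    rewrite -[in leqRHS](_ : (2 * 3 = 6)%N) // expnMn.
    move: le; move: (3 ^ (50 * n))%N (2 ^ M)%N (3 ^ M)%N (3 ^ (29 * n))%N => k p r z le.
    apply: leq_trans (_ : (k * c) * (6 * Delta * r * z) <= _)%N; first by clear; lia.
    by apply: leq_trans (leq_mul le (leqnn _)) _; clear; lia.
  - move=> v; have [_ _ _ _ [_ _ rare _]] := chainP _ (part_lt v).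
    set l := enum _; have ls : (size l <= Delta)%N by rewrite -cardE; apply: indegD.
    apply: le_trans (expect_dominated (R := R)
      (W := half_mix (D' (part v)) (window pos (a (part v).+1) (s (part v).+1))) _ _ _ _ _) _ => //.
    + exact: half_mix_ge0.
    + by move=> u; rewrite mem_enum => uv x; apply: dominated.
    apply: ler_pM; rewrite ?exprn_ge0 ?ler_weXn2l ?(le_trans ler01 R1) //.
      by apply: expect_ge0 => //; apply/nseq_ge0/half_mix_ge0.
    exact: rare.
  - move=> v l lP nB; have [_ _ _ _ [_ _ _ big]] := chainP _ (part_lt v).
    apply: big (levw v) _ nB => z zl; have [u uv Puz] := lP z zl.
    have [[uvE ll]|uvE] := edge_part _ _ uv.
      by right; exists (lev u); rewrite ?ll ?levw // -uvE.
    left; have [_ _ _ [_ /subsetP H] _] := chainP _ (part_lt u).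
    by rewrite -uvE; apply/H/Pv_supp.
  - by rewrite !mulr_gt0 ?exprn_gt0 // ?ltr0n // muln_gt0 expn_gt0.
  - rewrite ler_pdivlMr // mul1r; apply: le_trans mu1 _.
    by rewrite ler1n muln_gt0 expn_gt0 D0.
  - by rewrite ME; apply: expr_mixture_bound.
  - rewrite !natrM; move: (Delta%:R : rat) DR => d d0.
    rewrite -subr_gt0.
    have -> : mu / (2 * d) - (mu / (6 * d) + d / (6 * (d * d) / mu)) = mu / (6 * d).
      by field; rewrite !lt0r_neq0.
    by rewrite divr_gt0 // mulr_gt0.
by apply/contains_copyP; exists f.
Qed.

Local Close Scope ring_scope.

Theorem theorem1p7 (Delta w : nat) (V : finType) (e : rel V)
    (hDelta : max_degree e = Delta) (hw : graded_bandwidth_le e w) :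
  oriented_ramsey (graded_bandwidth_acyclic hw) <= 3 ^ (57 * Delta * w) * #|V|.
Proof.
rewrite /oriented_ramsey; case: ex_minnP => N _; apply.
exact: graded_bandwidth_forces.
Qed.
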